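(* Let $\mathbf{A}$ be a finite simple non-abelian Mal'cev algebra, let $e_1,\dots,e_n$ be all the idempotents of $\mathbf{A}$, let $\mathbf{B}$ be the countable atomless Boolean algebra, and let $x_1,\dots,x_n\in 2^\omega$ be distinct. (1) The class $\{\mathbf{A}^k : k\geq 1\}$ has the joint embedding property (JEP) and the amalgamation property (AP), and its generalized Fraïssé limit is isomorphic to the filtered Boolean power $(\mathbf{A}^{\mathbf{B}})^{x_1,\dots,x_n}_{e_1,\dots,e_n}$. (2) Let $\mathbf{F}$ be the free algebra of countable (infinite) rank in the variety $V$ generated by $\mathbf{A}$, and let $\theta$ be the smallest congruence of $\mathbf{F}$ such that $\mathbf{F}/\theta$ is in the variety $W$ generated by all proper subalgebras of $\mathbf{A}$. Then $\mathbf{F}$ embeds into $\mathbf{A}^{\mathbf{B}}$, and every $\theta$-class which is a subalgebra of $\mathbf{F}$ is isomorphic to $(\mathbf{A}^{\mathbf{B}})^{x_1,\dots,x_n}_{e_1,\dots,e_n}$.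
   Context: An algebra is a nonempty set with a family of finitary operations. It is Mal'cev if it has a ternary term operation $m$ satisfying $m(x,x,y)=y=m(y,x,x)$. A Mal'cev algebra is abelian if its basic operations can be represented as affine functions over a module; otherwise it is non-abelian. An element $e$ of an algebra $\mathbf{A}$ is an idempotent if $\{e\}$ is a subalgebra of $\mathbf{A}$. The Stone space $X$ of a Boolean algebra $\mathbf{B}$ is its set of ultrafilters with basic open sets $\{x\in X : b\in x\}$, $b\in B$. The countable atomless Boolean algebra is unique up to isomorphism and its Stone space is the Cantor space $2^\omega$. The Boolean power $\mathbf{A}^{\mathbf{B}}$ is the subalgebra of the direct power $\mathbf{A}^X$ whose elements are the continuous functions $f\colon X\to A$, where $A$ is discrete. For pairwise distinct $x_1,\dots,x_n\in X$ and idempotents $e_1,\dots,e_n$ of $\mathbf{A}$, the filtered Boolean power $(\mathbf{A}^{\mathbf{B}})^{x_1,\dots,x_n}_{e_1,\dots,e_n}$ is the subalgebra of $\mathbf{A}^{\mathbf{B}}$ with universe $\{f\in A^{\mathbf{B}} : f(x_1)=e_1,\dots,f(x_n)=e_n\}$. A class $K$ of structures has the JEP if any $\mathbf{P},\mathbf{Q}\in K$ both embed into some $\mathbf{R}\in K$. It has the AP if for all $\mathbf{P},\mathbf{Q},\mathbf{R}\in K$ and embeddings $\varphi\colon\mathbf{P}\to\mathbf{Q}$, $\psi\colon\mathbf{P}\to\mathbf{R}$ there exist $\mathbf{S}\in K$ and embeddings $\varphi'\colon\mathbf{Q}\to\mathbf{S}$, $\psi'\colon\mathbf{R}\to\mathbf{S}$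 with $\varphi'\varphi=\psi'\psi$. For a countable class $K$ of finitely generated structures of the same type with the JEP and AP, the generalized Fraïssé limit of $K$ is the (unique up to isomorphism) countable structure $\mathbf{D}$ such that: (i) up to isomorphism, the finitely generated substructures of $\mathbf{D}$ are exactly the finitely generated substructures of members of $K$; (ii) $\mathbf{D}$ is a direct limit of structures in $K$; (iii) every isomorphism between substructures of $\mathbf{D}$ that are isomorphic to members of $K$ extends to an automorphism of $\mathbf{D}$. *)

(* Defs.v *)
From HB Require Import structures.
From mathcomp Require Import all_boot all_order all_algebra.
From mathcomp Require Import boolp classical_sets functions cardinality.
From mathcomp Require Import topology.

Set Implicit Arguments.
Unset Strict Implicit.
Unset Printing Implicit Defensive.

Import Order.Theory GRing.Theory.
Local Open Scope classical_set_scope.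

Record signature := Signature { symbol :> Type; arity : symbol -> nat }.

Record algebra (sg : signature) := Algebra {
  carrier :> Type;
  op : forall o : sg, ('I_(arity o) -> carrier) -> carrier;
  algebra_nonempty : inhabited carrier }.

Arguments op {sg a} o v.

Section Morphisms.
Variable sg : signature.
Implicit Types A B : algebra sg.

Definition is_hom A B (h : A -> B) :=
  forall (o : sg) (v : 'I_(arity o) -> A), h (op o v) = op o (h \o v).

Definition is_embedding A B (h : A -> B) := is_hom h /\ injective h.

Definition is_iso A B (h : A -> B) := is_hom h /\ bijective h.

Definition embeds A B := exists h : A -> B, is_embedding h.

Definition isomorphic A B := exists h : A -> B, is_iso h.

End Morphisms.

Section Subalgebras.
Variables (sg : signature) (A : algebra sg).

Definition op_closed (S : set A) :=
  forall (o : sg) (v : 'I_(arity o) -> A), (forall i, S (v i)) -> S (op o v).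

Record subuniverse := Subuniverse {
  subuniverse_set :> set A;
  subuniverse_nonempty : subuniverse_set !=set0;
  subuniverse_closed : op_closed subuniverse_set }.

Definition sub_op (S : subuniverse) (o : sg)
    (v : 'I_(arity o) -> {a | subuniverse_set S a}) :
    {a | subuniverse_set S a} :=
  exist _ (op o (fun i => sval (v i)))
    (subuniverse_closed (fun i => svalP (v i))).

Lemma sub_nonempty (S : subuniverse) : inhabited {a | subuniverse_set S a}.
Proof. by case: (subuniverse_nonempty S) => a Sa; exists; exists a. Qed.

Definition subalgebra (S : subuniverse) : algebra sg :=
  Algebra (@sub_op S) (sub_nonempty S).

Definition finitely_generated :=
  exists G : set A, finite_set G /\
    forall S : set A, op_closed S -> G `<=` S -> S = [set: A].

Definition idempotent_elt (e : A) := op_closed [set e].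

End Subalgebras.

Section Products.
Variable sg : signature.

Definition product_op (I : Type) (P : I -> algebra sg) (o : sg)
    (v : 'I_(arity o) -> forall i, P i) : forall i, P i :=
  fun i => op o (fun k => v k i).

Lemma product_nonempty (I : Type) (P : I -> algebra sg) :
  inhabited (forall i, P i).
Proof.
have h i : exists x : P i, True by case: (algebra_nonempty (P i)) => x; exists x.
by exists => i; exact: (sval (cid (h i))).
Qed.

Definition product_algebra (I : Type) (P : I -> algebra sg) : algebra sg :=
  Algebra (@product_op I P) (product_nonempty P).

Definition power (A : algebra sg) (X : Type) : algebra sg :=
  product_algebra (fun _ : X => A).

Definition finite_powers (A P : algebra sg) : Prop :=
  exists2 k : nat, (1 <= k)%N & P = power A 'I_k.

End Products.

Section Congruences.
Variables (sg : signature) (A : algebra sg).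

Record congruence := Congruence {
  cong_rel :> A -> A -> Prop;
  cong_refl : forall a, cong_rel a a;
  cong_sym : forall a b, cong_rel a b -> cong_rel b a;
  cong_trans : forall b a c, cong_rel a b -> cong_rel b c -> cong_rel a c;
  cong_op : forall (o : sg) (v w : 'I_(arity o) -> A),
    (forall i, cong_rel (v i) (w i)) -> cong_rel (op o v) (op o w) }.

Definition congruence_class (theta : congruence) (C : set A) :=
  exists a, C = [set b | theta a b].

Section Quotient.
Variable theta : congruence.

Definition quotient_carrier := {C : set A | congruence_class theta C}.

Definition class_of (a : A) : quotient_carrier :=
  exist _ [set b | theta a b] (ex_intro _ a erefl).

Definition class_repr (C : quotient_carrier) : A := sval (cid (svalP C)).

Definition quotient_op (o : sg) (v : 'I_(arity o) -> quotient_carrier) :=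
  class_of (op o (fun i => class_repr (v i))).

Lemma class_reprE (a : A) : theta a (class_repr (class_of a)).
Proof.
rewrite /class_repr; case: cid => b /= Cb.
have : [set c | theta b c] a by rewrite -Cb; exact: cong_refl.
by move=> ba; exact: cong_sym.
Qed.

Lemma quotient_opE (o : sg) (v : 'I_(arity o) -> A) :
  quotient_op (fun i => class_of (v i)) = class_of (op o v).
Proof.
have vr : theta (op o v) (op o (fun i => class_repr (class_of (v i)))).
  by apply: cong_op => i; exact: class_reprE.
apply: eq_exist; apply/seteqP; split=> c /=; first exact: cong_trans.
by apply: cong_trans; exact: cong_sym.
Qed.

Lemma quotient_nonempty : inhabited quotient_carrier.
Proof. by case: (algebra_nonempty A) => a; exists; exact: class_of a. Qed.

Definition quotient : algebra sg := Algebra quotient_op quotient_nonempty.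

End Quotient.

Definition simple :=
  (exists a b : A, a <> b) /\
  forall theta : congruence,
    (forall a b, theta a b -> a = b) \/ (forall a b, theta a b).

End Congruences.

Section Malcev.
Variable sg : signature.

Inductive term (V : Type) : Type :=
| Var of V
| App (o : sg) of 'I_(arity o) -> term V.

Fixpoint eval (A : algebra sg) (V : Type) (rho : V -> A) (t : term V) : A :=
  match t with
  | Var v => rho v
  | App o ts => op o (fun i => eval rho (ts i))
  end.

Definition malcev (A : algebra sg) :=
  exists m : term 'I_3, forall x y : A,
    eval (tnth [tuple x; x; y]) m = y /\ eval (tnth [tuple y; x; x]) m = y.

(* Meaningful for Mal'cev algebras: up to a bijection phi of A with a module M,
   every basic operation is an affine map of M. *)
Definition abelian (A : algebra sg) :=
  exists (R : pzRingType) (M : lmodType R) (phi : A -> M),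
    bijective phi /\
    forall o : sg, exists (r : 'I_(arity o) -> R) (c : M),
      forall v : 'I_(arity o) -> A,
        phi (op o v) = (\sum_i r i *: phi (v i) + c)%R.

End Malcev.

Section Varieties.
Variable sg : signature.
Implicit Types (C K : algebra sg -> Prop).

(* The index type of a product may be empty, so that every variety contains
   the one-element algebras. *)
Definition is_variety C :=
  [/\ forall (P Q : algebra sg) (h : P -> Q),
        is_hom h -> (forall q, exists p, h p = q) -> C P -> C Q,
      forall (P : algebra sg) (S : subuniverse P), C P -> C (subalgebra S) &
      forall (I : Type) (P : I -> algebra sg),
        (forall i, C (P i)) -> C (product_algebra P)].

Definition variety_generated K (P : algebra sg) : Prop :=
  forall C, is_variety C -> (forall Q, K Q -> C Q) -> C P.

Definition proper_subalgebras (A P : algebra sg) : Prop :=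
  exists2 S : subuniverse A, (S : set A) <> [set: A] & P = subalgebra S.

Definition is_free_over (X : Type) C (F : algebra sg) (g : X -> F) :=
  C F /\
  forall (P : algebra sg) (f : X -> P), C P ->
    exists! h : F -> P, is_hom h /\ forall x, h (g x) = f x.

Definition is_smallest_congruence_with_quotient_in C (F : algebra sg)
    (theta : congruence F) :=
  C (quotient theta) /\
  forall eta : congruence F, C (quotient eta) ->
    forall a b, theta a b -> eta a b.

End Varieties.

Section Fraisse.
Variable sg : signature.
Implicit Types (K : algebra sg -> Prop) (P Q R D : algebra sg).

Definition JEP K :=
  forall P Q, K P -> K Q -> exists R, [/\ K R, embeds P R & embeds Q R].

Definition AP K :=
  forall P Q R (phi : P -> Q) (psi : P -> R), K P -> K Q -> K R ->
    is_embedding phi -> is_embedding psi ->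
    exists (S : algebra sg) (phi' : Q -> S) (psi' : R -> S),
      [/\ K S, is_embedding phi', is_embedding psi' & phi' \o phi = psi' \o psi].

Definition is_fg_substructure_of P D :=
  exists S : subuniverse D,
    finitely_generated (subalgebra S) /\ isomorphic P (subalgebra S).

(* As in JEP and AP, the morphisms of a directed system are embeddings. *)
Record directed_system K := DirectedSystem {
  ds_index : Type;
  ds_le : ds_index -> ds_index -> Prop;
  ds_inhabited : inhabited ds_index;
  ds_le_refl : forall i, ds_le i i;
  ds_le_trans : forall j i k, ds_le i j -> ds_le j k -> ds_le i k;
  ds_le_directed : forall i j, exists k, ds_le i k /\ ds_le j k;
  ds_obj :> ds_index -> algebra sg;
  ds_objP : forall i, K (ds_obj i);
  ds_map : forall i j, ds_le i j -> ds_obj i -> ds_obj j;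
  ds_map_embedding : forall i j (ij : ds_le i j), is_embedding (ds_map ij);
  ds_map_id : forall i (ii : ds_le i i) x, ds_map ii x = x;
  ds_map_comp : forall i j k (ij : ds_le i j) (jk : ds_le j k) (ik : ds_le i k) x,
    ds_map jk (ds_map ij x) = ds_map ik x }.

Definition is_cocone K (T : directed_system K) D (c : forall i, T i -> D) :=
  (forall i, is_hom (c i)) /\
  forall i j (ij : ds_le i j) x, c j (ds_map ij x) = c i x.

Definition is_direct_limit K (T : directed_system K) D :=
  exists c : forall i, T i -> D, is_cocone c /\
    forall (E : algebra sg) (f : forall i, T i -> E), is_cocone f ->
      exists! h : D -> E, is_hom h /\ forall i x, h (c i x) = f i x.

(* K is meant to be a countable class of finitely generated algebras having
   the JEP and the AP; D is then unique up to isomorphism. *)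
Definition is_generalized_fraisse_limit K D :=
  [/\ countable [set: D],
      forall P, is_fg_substructure_of P D <->
        exists2 Q, K Q & is_fg_substructure_of P Q,
      exists T : directed_system K, is_direct_limit T D &
      forall (S T : subuniverse D) (h : subalgebra S -> subalgebra T),
        (exists2 Q, K Q & isomorphic (subalgebra S) Q) ->
        (exists2 Q, K Q & isomorphic (subalgebra T) Q) ->
        is_iso h ->
        exists g : D -> D, is_iso g /\
          forall s : subalgebra S, g (sval s) = sval (h s)].

End Fraisse.

Section Stone.
Local Open Scope order_scope.
Variables (d : Order.disp_t) (B : ctbDistrLatticeType d).

Definition countable_atomless :=
  [/\ countable [set: B], (\bot : B) != \top &
      forall b : B, \bot < b -> exists c : B, \bot < c < b].

Definition is_proper_filter (F : set B) :=
  [/\ F \top, ~ F \bot,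
      forall a b, F a -> F b -> F (a `&` b)%O &
      forall a b, a <= b -> F a -> F b].

Record stone_space := StonePoint {
  stone_set :> set B;
  stone_filter : is_proper_filter stone_set;
  stone_maximal : forall G : set B,
    is_proper_filter G -> stone_set `<=` G -> G = stone_set }.

HB.instance Definition _ := gen_eqMixin stone_space.
HB.instance Definition _ := gen_choiceMixin stone_space.

Definition stone_basic (b : B) : set stone_space := [set x | stone_set x b].

Definition stone_open (U : set stone_space) :=
  forall x, U x -> exists2 b, stone_basic b x & stone_basic b `<=` U.

Lemma stone_openT : stone_open setT.
Proof. by move=> x _; exists \top => //; case: (stone_filter x). Qed.

Lemma stone_openI (U V : set stone_space) :
  stone_open U -> stone_open V -> stone_open (U `&` V)%classic.
Proof.
move=> oU oV x [/oU[b xb bU] /oV[c xc cV]]; exists (b `&` c)%O.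
  by case: (stone_filter x) => _ _ xI _; exact: xI.
move=> y ybc; have [_ _ _ yS] := stone_filter y.
by split; [apply: bU|apply: cV]; apply: yS ybc; rewrite ?leIl ?leIr.
Qed.

Lemma stone_open_bigU (I : Type) (f : I -> set stone_space) :
  (forall i, stone_open (f i)) -> stone_open (\bigcup_i f i).
Proof.
move=> fo x [i _ /fo[b xb bf]]; exists b => // y /bf fy.
by exists i.
Qed.

HB.instance Definition _ := isOpenTopological.Build stone_space
  stone_openT stone_openI stone_open_bigU.

Lemma stone_openE (U : set stone_space) : open U = stone_open U.
Proof. by []. Qed.

Lemma stone_basic_open (b : B) : open (stone_basic b).
Proof. by rewrite stone_openE => x xb; exists b. Qed.

Lemma stone_prime (x : stone_space) (b : B) :
  stone_basic b x \/ stone_basic (~` b)%O x.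
Proof.
have [xT x0 xI xS] := stone_filter x.
have [[a xa ab0]|ab] := pselect (exists2 a, stone_set x a & (a `&` b)%O = \bot).
  right; apply: xS xa.
  by rewrite -[a](joinIB b) ab0 join0x leBC.
left; rewrite /stone_basic /=.
pose G := [set c | exists2 a, stone_set x a & (a `&` b)%O <= c].
rewrite -(@stone_maximal x G); first last.
- by move=> a xa; exists a => //; exact: leIl.
- split.
  + by exists \top => //; exact: lex1.
  + by case=> a xa; rewrite lex0 => /eqP ab0; apply: ab; exists a.
  + move=> c c' [a xa ac] [a' xa' ac']; exists (a `&` a')%O; first exact: xI.
    rewrite lexI (le_trans _ ac) ?(le_trans _ ac') //.
      by rewrite leI2 // leIr.
    by rewrite leI2 // leIl.
  + by move=> c c' cc' [a xa ac]; exists a => //; exact: le_trans cc'.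
by exists \top => //; rewrite meet1x.
Qed.

Lemma stone_basicC (b : B) : (~` stone_basic b)%classic = stone_basic (~` b)%O.
Proof.
apply/seteqP; split=> x /=; first by case: (stone_prime x b).
have [_ x0 xI _] := stone_filter x.
by move=> xCb xb; apply: x0; rewrite -(meetxC b); exact: xI.
Qed.

Lemma stone_separation (x y : stone_space) :
  x <> y -> exists b, stone_basic b x /\ ~ stone_basic b y.
Proof.
move=> xy; apply: contrapT => nb; apply: xy.
have yx : stone_set y = stone_set x.
  apply: stone_maximal; first exact: stone_filter.
  by move=> b xb; apply: contrapT => yb; apply: nb; exists b.
case: x y yx {nb} => [X fX mX] [Y fY mY] /= YX; subst Y.
by congr StonePoint; exact: Prop_irrelevance.
Qed.

End Stone.

Section BooleanPowers.
Variables (sg : signature) (A : algebra sg).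
Variables (d : Order.disp_t) (B : ctbDistrLatticeType d).

(* The alias [classic] only provides the choice structure under which the
   discrete topology is defined. *)
Definition continuous_functions : set (power A (stone_space B)) :=
  [set f | continuous (f : stone_space B -> discrete_topology {classic A})].

Lemma continuous_functionsP (f : power A (stone_space B)) :
  continuous_functions f <->
  forall x, exists2 b, stone_basic b x &
    forall y, stone_basic b y -> f y = f x.
Proof.
split=> [cf x|lf].
  have := cf x [set f x] (discrete_set1 (f x : discrete_topology {classic A})).
  by rewrite nbhsE /= => -[U [/[!stone_openE] oU Ux] Uf]; have [b xb bU] := oU _ Ux;
     exists b => // y /bU /Uf.
move=> x U /nbhs_singleton Ux.
have [b xb bf] := lf x; rewrite nbhsE /=; exists (stone_basic b).
  by split=> //; exact: stone_basic_open.
by move=> y /bf /= ->.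
Qed.

Lemma continuous_functions_nonempty : continuous_functions !=set0.
Proof.
case: (algebra_nonempty A) => a; exists (fun=> a); exact: cst_continuous.
Qed.

Lemma continuous_functions_closed : op_closed continuous_functions.
Proof.
move=> o v cv; apply/continuous_functionsP => x.
have /choice[b bP] i : exists b, stone_basic b x /\
    forall y, stone_basic b y -> v i y = v i x.
  by have /continuous_functionsP/(_ x)[b xb bv] := cv i; exists b.
exists (\meet_(i < arity o) b i)%O.
  have [xT _ xI _] := stone_filter x.
  by apply: (big_ind (stone_set x)) => // i _; have [] := bP i.
move=> y yb; rewrite /= /product_op; congr op; apply/funext => i.
have [_] := bP i; apply; have [_ _ _ yS] := stone_filter y.
by apply: yS yb; exact: meets_inf.
Qed.

Definition boolean_power : algebra sg :=
  subalgebra (Subuniverse continuous_functions_nonempty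
                          continuous_functions_closed).

Section Filtered.
Variables (n : nat) (e : 'I_n -> A) (x : 'I_n -> stone_space B).
Hypothesis e_idem : forall i, idempotent_elt (e i).
Hypothesis x_inj : injective x.

Definition filtered_set : set boolean_power :=
  [set f | forall i, sval f (x i) = e i].

Lemma filtered_set_nonempty : filtered_set !=set0.
Proof.
have /choice[b bP] (ij : 'I_n * 'I_n) : exists b, stone_basic b (x ij.1) /\
    (ij.1 != ij.2 -> ~ stone_basic b (x ij.2)).
  have [->|/eqP nij] := eqVneq ij.1 ij.2.
    by exists \top%O; split=> //; have [] := stone_filter (x ij.2).
  have [|c [c1 c2]] := @stone_separation _ B (x ij.1) (x ij.2).
    by move=> /x_inj.
  by exists c.
pose c i := (\meet_(j < n) b (i, j))%O.
have cx i : stone_basic (c i) (x i).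
  have [xT _ xI _] := stone_filter (x i).
  by apply: (big_ind (stone_set (x i))) => // j _; have [] := bP (i, j).
have ncx i j : stone_basic (c i) (x j) -> i = j.
  move=> cij; apply/eqP; apply: contrapT => /negP ij.
  have [_ /(_ ij)] := bP (i, j); apply.
  have [_ _ _ yS] := stone_filter (x j).
  by apply: yS cij; exact: meets_inf.
have [a] := algebra_nonempty A.
pose f (y : stone_space B) :=
  if [pick i | `[<stone_basic (c i) y>]] is Some i then e i else a.
have fc : continuous_functions f.
  apply/continuous_functionsP => y.
  have /choice[g gP] i : exists g, stone_basic g y /\
      forall z, stone_basic g z -> stone_basic (c i) z <-> stone_basic (c i) y.
    have [yc|yc] := stone_prime y (c i); [exists (c i)|exists (~` c i)%O] => //.
    by split=> // z; move: yc; rewrite -stone_basicC.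
  exists (\meet_(i < n) g i)%O.
    have [xT _ xI _] := stone_filter y.
    by apply: (big_ind (stone_set y)) => // i _; have [] := gP i.
  move=> z zg; rewrite /f; congr (if _ is Some i then e i else a).
  apply: eq_pick => i; apply: asbool_equiv_eq.
  have [_] := gP i; apply; have [_ _ _ zS] := stone_filter z.
  by apply: zS zg; exact: meets_inf.
exists (exist _ f fc) => i; rewrite /= /f; case: pickP => [j /asboolP/ncx -> //|].
by move=> /(_ i)/asboolP; case.
Qed.

Lemma filtered_set_closed : op_closed filtered_set.
Proof. by move=> o v vP i; apply: e_idem => k; exact: vP. Qed.

Definition filtered_boolean_power : algebra sg :=
  subalgebra (Subuniverse filtered_set_nonempty filtered_set_closed).

End Filtered.
End BooleanPowers.

(* Main.v *)
(* Let m be the Mal'cev term. If congruences N1, N2 of an algebra F satisfy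
   N1 /\ N2 <= ker h for a surjective homomorphism h : F -> A, but neither lies
   below ker h, then comparing 2x2 matrices over F shows that m : A^3 -> A is a
   homomorphism, which makes A affine. So for non-abelian A such kernels are
   meet-prime: homomorphisms A^k -> A are constant idempotents or projections
   followed by automorphisms, and finitely many surjective homomorphisms to A
   with distinct kernels are independent.

   A countable algebra D that is a directed union of finite powers of A, where
   every coordinate and every constant idempotent can be split into arbitrarily
   many coordinates, therefore absorbs every embedding A^k -> A^l over a copy of
   A^k in D. A back-and-forth argument makes all such D isomorphic and
   homogeneous. Both the filtered Boolean power (by atomlessness, each idempotent
   occurring at exactly one prescribed point) and the theta-classes have this
   property. For the latter, F is an algebra of functions of sequences r : nat ->
   A, theta is equality at the sequences that do not generate A, and coordinates
   are orbits under Aut(A) of finite generating tuples. *)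
Require Import Defs.
From HB Require Import structures.
From mathcomp Require Import all_boot all_order all_algebra.
From mathcomp Require Import boolp classical_sets functions cardinality.
From mathcomp Require Import topology.

Set Implicit Arguments.
Unset Strict Implicit.
Unset Printing Implicit Defensive.

Local Open Scope classical_set_scope.

(** The form of [rich] is dictated by the extension step. By meet-primeness each of the l
    coordinates of an embedding A^k -> A^l is either an automorphism applied to a coordinate of A^k
    or a constant idempotent. To place A^l in D over a given copy of A^k, each of these l maps needs
    a coordinate of a larger box of its own that restricts to it up to an automorphism. Having at
    least l candidates for each of them makes a greedy choice succeed. This is why constant
    idempotents must split too, and why every idempotent must occur among the e_i: all elements of D
    take the value e_i at x_i, and the small pieces near x_i supply new coordinates that restrict to
    e_i. In a theta-class this role falls to the constant sequence at the idempotent, continued by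
    entries that generate A. Uniqueness of the limit is not presupposed. For an arbitrary limit,
    extension comes from homogeneity, and covering comes from the universal property of the direct
    limit, which has to yield that the cocone is injective and jointly surjective. *)

Lemma finite_set_enum (T : Type) (E : set T) :
  finite_set E -> exists n (u : 'I_n -> T), E `<=` range u.
Proof.
move=> /finite_setP[n] /card_esym /card_bijP[f [g fK gK]].
exists n, (fun i : 'I_n => val (f (SigSub (mem_set (ltn_ord i : `I_n i))))).
move=> t /mem_set Et.
exists (Ordinal (set_mem (valP (g (SigSub Et))) : (_ < n)%N)) => //=.
rewrite -[t in RHS]/(val (SigSub Et : set_type E)) -[SigSub Et in RHS]gK.
by congr (val (f _)); apply: val_inj.
Qed.

Lemma dep_choice (X : Type) (Y : X -> Type) (R : forall x, Y x -> Prop) :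
  (forall x, exists y, R x y) -> exists f : forall x, Y x, forall x, R x (f x).
Proof. by move=> ex; exists (fun x => sval (cid (ex x))) => x; case: cid. Qed.

Lemma directed_family (I T : Type) (U : I -> set T) (n : nat) (v : 'I_n -> T) :
  inhabited I -> (forall i j, exists k, U i `<=` U k /\ U j `<=` U k) ->
  (forall a, exists i, U i (v a)) -> exists i, forall a, U i (v a).
Proof.
move=> [i0] dir; elim: n v => [|n IH] v Uv; first by exists i0 => -[].
have [i Ui] := IH (fun a => v (lift ord0 a)) (fun a => Uv _).
have [j Uj] := Uv ord0.
have [k [ik jk]] := dir i j.
exists k => a; case: (unliftP ord0 a) => [b|] ->; [exact/ik/Ui|exact/jk].
Qed.

Lemma directed_finite_set (I T : Type) (U : I -> set T) (E : set T) :
  inhabited I -> (forall i j, exists k, U i `<=` U k /\ U j `<=` U k) ->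
  (forall t, exists i, U i t) -> finite_set E -> exists i, E `<=` U i.
Proof.
move=> I0 dir cov /finite_set_enum[n [u Eu]].
have [i Ui] := directed_family I0 dir (fun a => cov (u a)).
by exists i => t /Eu[a _ <-].
Qed.

(** * Homomorphisms, embeddings and finitely generated subalgebras *)

Section Homs.
Variable sg : signature.
Implicit Types A B C D P Q : algebra sg.

Lemma hom_comp A B C (f : A -> B) (g : B -> C) :
  is_hom f -> is_hom g -> is_hom (g \o f).
Proof. by move=> hf hg o v; rewrite /= hf hg. Qed.

Lemma embedding_comp A B C (f : A -> B) (g : B -> C) :
  is_embedding f -> is_embedding g -> is_embedding (g \o f).
Proof. by move=> [hf fi] [hg gi]; split; [exact: hom_comp|exact: inj_comp]. Qed.

Lemma embeds_trans A B C : embeds A B -> embeds B C -> embeds A C.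
Proof. by move=> [f ef] [g eg]; exists (g \o f); exact: embedding_comp. Qed.

Lemma embedding_id A : is_embedding (@id A).
Proof. by split=> [o v //|a b]. Qed.

Lemma iso_inv A B (f : A -> B) : is_iso f ->
  exists g : B -> A, [/\ is_iso g, cancel f g & cancel g f].
Proof.
move=> [hf [g fK gK]]; exists g; split=> //; split; last by exists f.
move=> o v; apply: (can_inj fK); rewrite gK hf.
by congr op; apply/funext => i /=; rewrite gK.
Qed.

Lemma iso_embedding A B (f : A -> B) : is_iso f -> is_embedding f.
Proof. by move=> [hf /bij_inj fi]. Qed.

Lemma hom_eval A B V (h : A -> B) (rho : V -> A) (t : term sg V) :
  is_hom h -> h (Defs.eval rho t) = Defs.eval (h \o rho) t.
Proof.
move=> hh; elim: t => [//|o ts IH] /=; rewrite hh; congr op.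
by apply/funext => i /=; rewrite IH.
Qed.

Lemma range_op_closed A B (h : A -> B) : is_hom h -> op_closed (range h).
Proof.
move=> hh o v vP; have {vP} /choice[w wv] i : exists a, h a = v i.
  by have [a _ av] := vP i; exists a.
by exists (op o w) => //; rewrite hh; congr op; apply/funext => i /=.
Qed.

Lemma range_nonempty A B (h : A -> B) : range h !=set0.
Proof. by have [a] := algebra_nonempty A; exists (h a); exists a. Qed.

Definition range_sub A B (h : A -> B) (hh : is_hom h) : subuniverse B :=
  Subuniverse (range_nonempty h) (range_op_closed hh).

Lemma sval_inj T (Q : set T) (a b : {t | Q t}) : sval a = sval b -> a = b.
Proof.
by case: a b => [a Qa] [b Qb] /= ab; subst b; congr exist; exact: Prop_irrelevance.
Qed.

Lemma sval_embedding A (S : subuniverse A) :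
  is_embedding (fun s : subalgebra S => sval s : A).
Proof. by split=> // a b; exact: sval_inj. Qed.

Lemma lift_embedding A D Q (c : Q -> D) (f : A -> D) :
  is_embedding c -> is_hom f -> range f `<=` range c ->
  exists g : A -> Q, is_hom g /\ forall a, c (g a) = f a.
Proof.
move=> [hc ci] hf fc.
have /choice[g gP] a : exists q, c q = f a.
  by have [|q _ qf] := fc (f a); [exists a|exists q].
exists g; split=> // o v; apply: ci; rewrite gP hf hc.
by congr op; apply/funext => i /=; rewrite gP.
Qed.

Lemma lift_embedding_inj A D Q (c : Q -> D) (f : A -> D) (g : A -> Q) :
  is_hom g -> is_embedding f -> (forall a, c (g a) = f a) -> is_embedding g.
Proof.
by move=> hg [_ fi] gP; split=> // a b ab; apply: fi; rewrite -!gP ab.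
Qed.

Lemma iso_range A B (h : A -> B) (hh : is_embedding h) :
  exists f : A -> subalgebra (range_sub hh.1),
    is_iso f /\ forall a, sval (f a) = h a.
Proof.
have rP a : range h (h a) by exists a.
exists (fun a => exist _ (h a) (rP a)); split=> //; split.
  by move=> o v; apply: sval_inj => /=; rewrite hh.1.
have /choice[g gP] (s : subalgebra (range_sub hh.1)) : exists a, h a = sval s.
  by have [a _ ah] := svalP s; exists a.
exists g => [a|s]; first by apply: hh.2; rewrite gP.
by apply: sval_inj; rewrite /= gP.
Qed.

Lemma finitely_generated_iso P Q :
  isomorphic P Q -> finitely_generated P -> finitely_generated Q.
Proof.
move=> [f [hf [g fK gK]]] [G [Gfin Ggen]]; exists (f @` G); split.
  exact: finite_image.
move=> S Sc GS; have E : [set p | S (f p)] = [set: P].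
  apply: Ggen; first by move=> o v Sv /=; rewrite hf; apply: Sc.
  by move=> p Gp /=; apply: GS; exists p.
apply/seteqP; split=> // q _; rewrite -[q]gK.
by have : [set: P] (g q) by []; rewrite -E.
Qed.

Lemma is_fg_substructureP P D :
  is_fg_substructure_of P D <-> finitely_generated P /\ embeds P D.
Proof.
split=> [[S [Sfg [f isof]]]|[Pfg [f ef]]].
  have [g [isog _ _]] := iso_inv isof; split.
    by apply: finitely_generated_iso Sfg; exists g.
  exists ((fun s : subalgebra S => sval s) \o f).
  by apply: embedding_comp; [exact: iso_embedding|exact: sval_embedding].
have [g [isog _]] := iso_range ef.
exists (range_sub ef.1); split; last by exists g.
by apply: finitely_generated_iso Pfg; exists g.
Qed.

Lemma finite_finitely_generated P : finite_set [set: P] -> finitely_generated P.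
Proof.
move=> fP; exists setT; split=> // S _ TS.
by apply/seteqP; split.
Qed.

End Homs.

(** * Generalized Fraïssé limits through covering and extension *)

Section FraisseTheory.
Variables (sg : signature) (K : algebra sg -> Prop).
Hypothesis K_finite : forall P, K P -> finite_set [set: P].
Implicit Types P Q R D : algebra sg.

(** As members of [K] are finite, this is the internal form of being a direct limit of members of
    [K]. *)
Definition covered D := forall E : set D, finite_set E ->
  exists Q (c : Q -> D), [/\ K Q, is_embedding c & E `<=` range c].

(** A weak form of homogeneity that mentions no automorphism of [D]; it supplies a single step of
    the back-and-forth. *)
Definition extensible D := forall P Q (phi : P -> D) (mu : P -> Q),
  K P -> K Q -> is_embedding phi -> is_embedding mu ->
  exists psi : Q -> D, is_embedding psi /\ forall p, psi (mu p) = phi p.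

Definition universal D := forall P, K P -> embeds P D.

(** Encoded by graphs: inversion is transposition, and the union of a chain is an existential
    statement, whatever the parametrizing algebras [P] are. *)
Definition partial_iso D D' (G : D -> D' -> Prop) :=
  exists P (phi : P -> D) (phi' : P -> D'),
    [/\ K P, is_embedding phi, is_embedding phi' &
      forall d d', G d d' <-> exists p, phi p = d /\ phi' p = d'].

Lemma partial_iso_sym D D' (G : D -> D' -> Prop) :
  partial_iso G -> partial_iso (fun d' d => G d d').
Proof.
move=> [P [phi [phi' [KP ephi ephi' GP]]]]; exists P, phi', phi; split=> // d' d.
by rewrite GP; split=> -[p []]; exists p.
Qed.

Lemma finite_range P D (phi : P -> D) : K P -> finite_set (range phi).
Proof. by move=> KP; apply: finite_image; exact: K_finite. Qed.

(** A member [Q] of [K] covers the old domain together with [d]. The old parametrization factors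
    through [Q], so its image in [D'] extends to [Q]. *)
Lemma partial_iso_forth D D' (G : D -> D' -> Prop) (d : D) :
  covered D -> extensible D' -> partial_iso G ->
  exists G', [/\ partial_iso G', (forall d d', G d d' -> G' d d') &
    exists d', G' d d'].
Proof.
move=> covD extD' [P [phi [phi' [KP ephi ephi' GP]]]].
have [|Q [c [KQ ec Ec]]] := covD (range phi `|` [set d]).
  by rewrite finite_setU; split; [exact: finite_range|exact: finite_set1].
have [|mu [hmu muP]] := lift_embedding ec ephi.1.
  by move=> x xphi; apply: Ec; left.
have emu := lift_embedding_inj hmu ephi muP.
have [psi [epsi psiP]] := extD' P Q phi' mu KP KQ ephi' emu.
exists (fun d d' => exists q, c q = d /\ psi q = d'); split.
- by exists Q, c, psi.
- move=> x x' /GP[p [<- <-]]; exists (mu p).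
  by rewrite muP psiP.
- by have [|q _ <-] := Ec d; [right|exists (psi q), q].
Qed.

Lemma back_and_forth D D' (G0 : D -> D' -> Prop) :
  countable [set: D] -> covered D -> extensible D ->
  countable [set: D'] -> covered D' -> extensible D' ->
  partial_iso G0 ->
  exists g : D -> D', is_iso g /\ forall d d', G0 d d' -> g d = d'.
Proof.
move=> cD covD extD cD' covD' extD' pG0.
have /countable_injP[en eni] := cD; have /countable_injP[en' eni'] := cD'.
pose T := {G : D -> D' -> Prop | partial_iso G}.
(* Stage [n] puts the element of code [n], if there is one, into the domain and into the range. *)
have stepP (n : nat) (G : T) : exists G' : T,
  [/\ forall d d', sval G d d' -> sval G' d d',
      forall d, en d = n -> exists d', sval G' d d' &
      forall d', en' d' = n -> exists d, sval G' d d'].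
  have [G1 [pG1 GG1 G1n]] : exists G', [/\ partial_iso G',
      (forall d d', sval G d d' -> G' d d') &
      forall d, en d = n -> exists d', G' d d'].
    case: (pselect (exists d, en d = n)) => [[d dn]|nd].
      have [G' [pG' GG' [d' dd']]] := partial_iso_forth d covD extD' (svalP G).
      exists G'; split=> // x xn; exists d'.
      by have -> : x = d by apply: eni; rewrite ?inE // xn dn.
    exists (sval G); split=> //; first exact: svalP.
    by move=> d dn; case: nd; exists d.
  have [G2 [pG2 GG2 G2n]] : exists G', [/\ partial_iso G',
      (forall d d', G1 d d' -> G' d d') &
      forall d', en' d' = n -> exists d, G' d d'].
    case: (pselect (exists d, en' d = n)) => [[d dn]|nd]; last first.
      by exists G1; split=> // d dn; case: nd; exists d.
    have [G' [pG' GG' [d' dd']]] :=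
      partial_iso_forth d covD' extD (partial_iso_sym pG1).
    exists (fun x x' => G' x' x); split=> //.
    - exact: partial_iso_sym.
    - by move=> x x'; exact: GG'.
    - move=> x xn; exists d'.
      by have -> : x = d by apply: eni'; rewrite ?inE // xn dn.
  exists (exist _ G2 pG2); split=> //=.
  - by move=> d d' /GG1/GG2.
  - by move=> d /G1n[d' /GG2]; exists d'.
have /choice[step {}stepP] := fun nG : nat * T => stepP nG.1 nG.2.
pose G := fix G n := if n is n'.+1 then step (n', G n') else exist _ G0 pG0 : T.
have Gmono m n : (m <= n)%N -> forall d d', sval (G m) d d' -> sval (G n) d d'.
  move=> /subnK <-; elim: (n - m)%N => [//|k IH] d d' /IH.
  by rewrite addSn /=; case: (stepP ((k + m)%N, G (k + m)%N)) => + _ _; exact.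
have tot d : exists d', exists n, sval (G n) d d'.
  by have [_ /(_ d erefl)[d' dd'] _] := stepP (en d, G (en d));
     exists d', (en d).+1.
have tot' d' : exists d, exists n, sval (G n) d d'.
  by have [_ _ /(_ d' erefl)[d dd']] := stepP (en' d', G (en' d'));
     exists d, (en' d').+1.
have /choice[g gP] := tot; have /choice[g' g'P] := tot'.
have func d d1 d2 m n : sval (G m) d d1 -> sval (G n) d d2 -> d1 = d2.
  move=> /(Gmono m _ (leq_maxl m n)) + /(Gmono n _ (leq_maxr m n)).
  have [P [phi [phi' [_ ephi _ GP]]]] := svalP (G (maxn m n)).
  by move=> /GP[p [<- <-]] /GP[q [/ephi.2 -> <-]].
have func' d d1 d2 m n : sval (G m) d1 d -> sval (G n) d2 d -> d1 = d2.
  move=> /(Gmono m _ (leq_maxl m n)) + /(Gmono n _ (leq_maxr m n)).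
  have [P [phi [phi' [_ _ ephi' GP]]]] := svalP (G (maxn m n)).
  by move=> /GP[p [<- <-]] /GP[q [<- /ephi'.2 ->]].
exists g; split; first split.
(* Finitely many arguments and their images already lie in one stage, which is the graph of an
   isomorphism and hence closed under the operation. *)
- move=> o v; pose w i : D * D' := (v i, g (v i)).
  have [|||n nP] := @directed_family nat (D * D') (fun n x => sval (G n) x.1 x.2) _ w.
  + by constructor; exact: 0%N.
  + move=> i j; exists (maxn i j); split=> x; apply: Gmono.
      exact: leq_maxl.
    exact: leq_maxr.
  + by move=> a; exact: gP.
  have [m mP] := gP (op o v); apply: func mP _.
  have [P [phi [phi' [_ ephi ephi' GP]]]] := svalP (G n).
  have /choice[p pP] i : exists p, phi p = v i /\ phi' p = g (v i).
    by apply/GP; exact: nP.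
  apply/GP; exists (op o p); rewrite ephi.1 ephi'.1.
  by split; congr op; apply/funext => i /=; have [] := pP i.
- exists g' => [d|d'].
    by have [m mP] := gP d; have [n nP] := g'P (g d); exact: func' nP mP.
  by have [m mP] := gP (g' d'); have [n nP] := g'P d'; exact: func mP nP.
- by move=> d d' dd'; have [m mP] := gP d; apply: (func d _ _ m 0%N).
Qed.

Lemma covered_extensible_isomorphic D D' P : K P -> embeds P D -> embeds P D' ->
  countable [set: D] -> covered D -> extensible D ->
  countable [set: D'] -> covered D' -> extensible D' ->
  isomorphic D D'.
Proof.
move=> KP [phi ephi] [phi' ephi'] cD covD extD cD' covD' extD'.
have [|g [isog _]] := @back_and_forth D D'
    (fun d d' => exists p, phi p = d /\ phi' p = d') cD covD extD cD' covD' extD'.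
  by exists P, phi, phi'.
by exists g.
Qed.

Section Amalgamation.
Variable D : algebra sg.
Hypotheses (covD : covered D) (extD : extensible D) (uniD : universal D).

(** Reduces joint embedding and amalgamation to finding embeddings into [D]: a member of [K]
    containing both images is cut out of [D] at the end. *)
Lemma covered_pair P Q (phi : P -> D) (psi : Q -> D) :
  K P -> K Q -> is_embedding phi -> is_embedding psi ->
  exists (R : algebra sg) (c : R -> D) (phi' : P -> R) (psi' : Q -> R),
  [/\ K R, is_embedding c, is_embedding phi', is_embedding psi' &
    (forall p, c (phi' p) = phi p) /\ (forall q, c (psi' q) = psi q)].
Proof.
move=> KP KQ ephi epsi.
have [|R [c [KR ec Ec]]] := covD (E := range phi `|` range psi).
  by rewrite finite_setU; split; exact: finite_range.
have [|f [hf fP]] := lift_embedding ec ephi.1.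
  by move=> x xphi; apply: Ec; left.
have [|g [hg gP]] := lift_embedding ec epsi.1.
  by move=> x xphi; apply: Ec; right.
exists R, c, f, g; split=> //.
  exact: lift_embedding_inj fP.
exact: lift_embedding_inj gP.
Qed.

Lemma covered_JEP : JEP K.
Proof.
move=> P Q KP KQ; have [phi ephi] := uniD KP; have [psi epsi] := uniD KQ.
have [R [c [f [g [KR _ ef eg _]]]]] := covered_pair KP KQ ephi epsi.
by exists R; split=> //; [exists f|exists g].
Qed.

Lemma covered_AP : AP K.
Proof.
move=> P Q R phi psi KP KQ KR ephi epsi; have [i ei] := uniD KP.
have [f [ef fP]] := extD KP KQ ei ephi; have [g [eg gP]] := extD KP KR ei epsi.
have [S [c [f' [g' [KS ec ef' eg' [cf cg]]]]]] := covered_pair KQ KR ef eg.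
exists S, f', g'; split=> //; apply/funext => p /=; apply: ec.2.
by rewrite cf cg fP gP.
Qed.

(* The system is indexed by the images in D of embeddings of members of K: an
   index by the embeddings themselves would live in too large a universe. *)
Lemma covered_direct_limit : exists T : directed_system K, is_direct_limit T D.
Proof.
pose I := {S : set D |
  exists Q (c : Q -> D), [/\ K Q, is_embedding c & S = range c]}.
have /dep_choice[obj /dep_choice[c cP]] := fun i : I => svalP i.
have KI i : K (obj i) by have [] := cP i.
have ec i : is_embedding (c i) by have [] := cP i.
pose le (i j : I) := range (c i) `<=` range (c j).
have /dep_choice[m mP] (ij : {ij : I * I | le ij.1 ij.2}) :
    exists m : obj (sval ij).1 -> obj (sval ij).2,
    is_embedding m /\ forall x, c _ (m x) = c _ x.
  have [m [hm mP]] := lift_embedding (ec _) (ec (sval ij).1).1 (svalP ij).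
  by exists m; split=> //; exact: lift_embedding_inj mP.
pose map i j (ij : le i j) : obj i -> obj j := m (exist _ (i, j) ij).
have mapP i j (ij : le i j) : forall x, c j (map i j ij x) = c i x.
  by move=> x; exact: (mP (exist _ (i, j) ij)).2.
have cov (E : set D) : finite_set E -> exists i : I, E `<=` range (c i).
  move=> /covD[Q [f [KQ ef Ef]]].
  have SI : exists Q (c : Q -> D), [/\ K Q, is_embedding c & range f = range c].
    by exists Q, f.
  exists (exist _ (range f) SI).
  by have [_ _ /= <-] := cP (exist _ (range f) SI).
have I0 : inhabited I by have [i _] := cov _ (@finite_set0 D); constructor.
have dir i j : exists k, le i k /\ le j k.
  have [|k Ek] := cov (range (c i) `|` range (c j)).
    by rewrite finite_setU; split; exact: finite_range.
  by exists k; split=> x xi; apply: Ek; [left|right].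
have letr j i k : le i j -> le j k -> le i k by move=> ij jk x /ij/jk.
pose T := @DirectedSystem sg K I le I0 (fun i x xi => xi) letr dir obj KI map
  (fun i j ij => (mP (exist _ (i, j) ij)).1)
  (fun i ii x => (ec i).2 _ _ (mapP i i ii x))
  (fun i j k ij jk ik x => (ec k).2 _ _
     (etrans (mapP j k jk _) (etrans (mapP i j ij x) (esym (mapP i k ik x))))).
exists T, c; split; first by split=> [i|]; [exact: (ec i).1|exact: mapP].
move=> E f [hf fP].
have cov1 d : exists i : I, exists x, c i x = d.
  have [i iP] := cov _ (finite_set1 d).
  by have [|x _ xd] := iP d; [|exists i, x].
have fE i j x y : c i x = c j y -> f i x = f j y.
  move=> xy; have [k [ik jk]] := dir i j.
  rewrite -(fP i k ik) -(fP j k jk); congr (f k _); apply: (ec k).2.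
  by rewrite /= !mapP.
have /choice[h hP] d : exists e, forall i x, c i x = d -> f i x = e.
  have [i [x xd]] := cov1 d; exists (f i x) => j y yd.
  by apply: fE; rewrite xd yd.
exists h; split; first split.
- move=> o v.
  have [|||i iP] := @directed_family I D (fun i => range (c i)) _ v => //.
    by move=> a; have [i [x xv]] := cov1 (v a); exists i, x.
  have /choice[w wP] a : exists x, c i x = v a.
    by have [x _ xv] := iP a; exists x.
  rewrite -(hP (op o v) i (op o w)); last first.
    by rewrite (ec i).1; congr op; apply/funext => a /=.
  rewrite hf; congr op; apply/funext => a /=.
  by apply: hP.
- by move=> i x; symmetry; exact: hP.
- move=> h' [_ h'P]; apply/funext => d; have [i [x xd]] := cov1 d.
  by rewrite -(hP d i x xd) -xd h'P.
Qed.

Lemma covered_is_limit :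
  countable [set: D] -> is_generalized_fraisse_limit K D.
Proof.
move=> cD; split=> //.
- move=> P; rewrite is_fg_substructureP; split.
    move=> [Pfg [f ef]]; have [G [Gfin Ggen]] := Pfg.
    have [|Q [c [KQ ec Ec]]] := covD (E := f @` G); first exact: finite_image.
    have E : [set p | range c (f p)] = [set: P].
      apply: Ggen; last by move=> p Gp; apply: Ec; exists p.
      by move=> o v vP /=; rewrite ef.1; apply: (range_op_closed ec.1).
    exists Q => //; apply/is_fg_substructureP; split=> //.
    have [|g [hg gP]] := lift_embedding ec ef.1.
      move=> _ [p _ <-]; have : [set: P] p by [].
      by rewrite -E.
    by exists g; exact: lift_embedding_inj gP.
  move=> [Q KQ /is_fg_substructureP[Pfg PQ]]; split=> //.
  exact: embeds_trans PQ (uniD KQ).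
- exact: covered_direct_limit.
- move=> S T h [Q KQ [i isoi]] _ isoh.
  have [j [isoj ij ji]] := iso_inv isoi.
  pose phi : Q -> D := (fun s : subalgebra S => sval s) \o j.
  pose phi' : Q -> D := (fun s : subalgebra T => sval s) \o (h \o j).
  have [|g [isog gP]] := @back_and_forth D D
      (fun d d' => exists p, phi p = d /\ phi' p = d') cD covD extD cD covD extD.
    exists Q, phi, phi'; split=> //.
      by apply: embedding_comp (sval_embedding _); exact: iso_embedding.
    apply: embedding_comp (sval_embedding _).
    by apply: embedding_comp; exact: iso_embedding.
  exists g; split=> // s; apply: gP; exists (i s).
  by rewrite /phi /phi' /= ij.
Qed.

End Amalgamation.

Section LimitConverse.
Variable D : algebra sg.

(* Injectivity of the cocone is seen in the product of the system modulo
   eventual equality. *)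
Lemma direct_limit_covered (T : directed_system K) :
  is_direct_limit T D -> covered D.
Proof.
move=> [c [[hc cP] univ]].
(* The transition maps are made total, with a constant where [i] is not below [j], so that an
   element of [T i] yields a point of the whole product. Eventual equality ignores the added
   values. *)
have fun_of (i j : ds_index T) : exists f : T i -> T j,
    forall ij : ds_le i j, f = ds_map ij.
  case: (pselect (ds_le i j)) => ij; last first.
    by have [y] := algebra_nonempty (T j); exists (fun=> y).
  by exists (ds_map ij) => ij'; rewrite (Prop_irrelevance ij ij').
pose Pr := product_algebra (fun i => T i).
pose ev (f g : Pr) := exists i, forall j, ds_le i j -> f j = g j.
have evr f : ev f f by have [i] := ds_inhabited T; exists i.
have evs f g : ev f g -> ev g f by move=> [i iP]; exists i => j /iP.
have evt g f h : ev f g -> ev g h -> ev f h.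
  move=> [i iP] [j jP]; have [k [ik jk]] := ds_le_directed i j.
  exists k => l kl; rewrite iP ?jP //; first exact: ds_le_trans jk kl.
  exact: ds_le_trans ik kl.
have evop (o : sg) (v w : 'I_(arity o) -> Pr) :
    (forall i, ev (v i) (w i)) -> ev (op o v) (op o w).
  move=> vw.
  have [|||k kP] := @directed_family (ds_index T) (Pr * Pr)
      (fun i fg => forall j, ds_le i j -> fg.1 j = fg.2 j) _ (fun a => (v a, w a)).
  - exact: ds_inhabited.
  - move=> i j; have [k [ik jk]] := ds_le_directed i j; exists k.
    by split=> fg fgi l kl; apply: fgi; exact: ds_le_trans kl.
  - exact: vw.
  exists k => j kj; rewrite /= /product_op; congr op; apply/funext => a.
  exact: kP.
pose th := @Congruence sg Pr ev evr evs evt evop.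
have /dep_choice[f fP] (i : ds_index T) : exists f : T i -> Pr,
    forall x j (ij : ds_le i j), f x j = ds_map ij x.
  have /dep_choice[g gP] := fun_of i.
  by exists (fun x j => g j x) => x j ij; rewrite gP.
have classE a b : ev a b -> class_of th a = class_of th b.
  move=> ab; apply: sval_inj; apply/seteqP; split=> x /=.
    exact: evt (evs _ _ ab).
  exact: evt ab.
have [|h [[hh hP] _]] := univ (quotient th) (fun i x => class_of th (f i x)).
  split=> [i o v|i j ij x]; last first.
    apply: classE; exists j => k jk; rewrite (fP j _ _ jk).
    by rewrite (fP i _ k (ds_le_trans ij jk)); exact: ds_map_comp.
  apply: (etrans _ (esym (quotient_opE th (fun a => f i (v a))))).
  apply: classE; exists i => j ij.
  rewrite fP (ds_map_embedding ij).1 /= /product_op; congr op.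
  by apply/funext => a /=; rewrite fP.
have ec i : is_embedding (c i).
  split=> // x y /(congr1 h); rewrite !hP => /(congr1 sval)/seteqP[_ sub].
  have [j jP] : ev (f i x) (f i y) by exact: (sub (f i y) (evr _)).
  have [k [ik jk]] := ds_le_directed i j.
  by have := jP k jk; rewrite !(fP i _ k ik); exact: (ds_map_embedding ik).2.
have dir i j : exists k, range (c i) `<=` range (c k) /\ range (c j) `<=` range (c k).
  have [k [ik jk]] := ds_le_directed i j; exists k.
  by split=> _ [x _ <-]; [exists (ds_map ik x)|exists (ds_map jk x)].
(* The images exhaust [D]: they form a subalgebra through which the cocone factors, and by
   uniqueness the mediating map into it followed by the inclusion is the identity. *)
pose U := [set d | exists i, range (c i) d].
have U0 : U !=set0.
  have [i] := ds_inhabited T; have [x] := algebra_nonempty (T i).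
  by exists (c i x), i, x.
have Uc : op_closed U.
  move=> o v vP.
  have [i iP] := directed_family (ds_inhabited T) dir vP.
  by exists i; exact: (range_op_closed (hc i)).
pose SU := Subuniverse U0 Uc.
have UP i x : U (c i x) by exists i, x.
have [|k [[hk kP] _]] := univ (subalgebra SU) (fun i x => exist _ (c i x) (UP i x)).
  split=> [i o v|i j ij x]; apply: sval_inj; first by rewrite /= hc.
  exact: cP.
have Uall d : U d.
  have [|u [_ uU]] := univ D c; first by split.
  have -> : d = sval (k d).
    rewrite -[d in LHS]/(id d) -(uU id) //.
    rewrite (uU ((fun s : subalgebra SU => sval s) \o k)) //.
    by split=> [|i x]; [exact: hom_comp (sval_embedding _).1|rewrite /= kP].
  exact: svalP.
move=> E Efin.
have [i Ei] := directed_finite_set (ds_inhabited T) dir Uall Efin.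
by exists (T i), (c i); split=> //; exact: ds_objP.
Qed.

Lemma limit_covered : is_generalized_fraisse_limit K D -> covered D.
Proof. by move=> [_ _ [T /direct_limit_covered]]. Qed.

Lemma limit_universal : is_generalized_fraisse_limit K D -> universal D.
Proof.
move=> [_ fg _ _] P KP.
have /fg/is_fg_substructureP[] // : exists2 Q, K Q & is_fg_substructure_of P Q.
exists P => //; apply/is_fg_substructureP; split.
  exact/finite_finitely_generated/K_finite.
by exists id; exact: embedding_id.
Qed.

(** Universality gives some copy [psi] of [Q]. Homogeneity extends the isomorphism from the image of
    [psi \o mu] to the image of [phi] to an automorphism, which moves [psi] to the required
    place. *)
Lemma limit_extensible : is_generalized_fraisse_limit K D -> extensible D.
Proof.
move=> limD P Q phi mu KP KQ ephi emu.
have [psi epsi] := limit_universal limD KQ.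
have [_ _ _ homog] := limD.
have epm := embedding_comp emu epsi.
have [f [isof fP]] := iso_range epm; have [f' [isof' fK f'K]] := iso_inv isof.
have [k [isok kP]] := iso_range ephi; have [k' [isok' _ _]] := iso_inv isok.
have [|||g [isog gP]] := homog _ _ (k \o f').
- by exists P => //; exists f'.
- by exists P => //; exists k'.
- split; first by apply: hom_comp; [case: isof'|case: isok].
  by apply: bij_comp; [case: isok|case: isof'].
exists (g \o psi); split; first by apply: embedding_comp => //; exact: iso_embedding.
by move=> p; rewrite -kP -[p in RHS]fK -gP fP.
Qed.

End LimitConverse.

End FraisseTheory.

(** * An abelian group as a module over its endomorphism ring *)

(** Over this ring every additive map is multiplication by a scalar, so affine representability only
    requires operations that are additive up to a constant. *)
Definition endomorphism (V : zmodType) :=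
  {f : V -> V | {morph f : x y / (x + y)%R}}.

Section EndomorphismRing.
Import GRing.Theory.
Local Open Scope ring_scope.
Variable V : zmodType.
Implicit Types f g h : endomorphism V.

HB.instance Definition _ := gen_eqMixin (endomorphism V).
HB.instance Definition _ := gen_choiceMixin (endomorphism V).

Fact end_zero_morph : {morph (fun _ : V => 0 : V) : x y / x + y}.
Proof. by move=> x y; rewrite addr0. Qed.

Fact end_one_morph : {morph (@id V) : x y / x + y}.
Proof. by []. Qed.

Fact end_opp_morph f : {morph (fun x => - sval f x) : x y / x + y}.
Proof. by move=> x y; rewrite (svalP f) opprD. Qed.

Fact end_add_morph f g : {morph (fun x => sval f x + sval g x) : x y / x + y}.
Proof. by move=> x y; rewrite (svalP f) (svalP g) GRing.addrACA. Qed.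

Fact end_mul_morph f g : {morph sval f \o sval g : x y / x + y}.
Proof. by move=> x y; rewrite /= (svalP g) (svalP f). Qed.

Local Notation mkEnd := (exist (fun f : V -> V => {morph f : x y / x + y}) _).

Definition end_zero : endomorphism V := mkEnd end_zero_morph.
Definition end_one : endomorphism V := mkEnd end_one_morph.
Definition end_opp f : endomorphism V := mkEnd (end_opp_morph f).
Definition end_add f g : endomorphism V := mkEnd (end_add_morph f g).
Definition end_mul f g : endomorphism V := mkEnd (end_mul_morph f g).

Lemma endP f g : (forall x, sval f x = sval g x) -> f = g.
Proof. by move=> fg; apply: sval_inj; apply/funext. Qed.

Fact end_addA : associative end_add.
Proof. by move=> f g h; apply: endP => x /=; rewrite addrA. Qed.

Fact end_addC : commutative end_add.
Proof. by move=> f g; apply: endP => x /=; rewrite addrC. Qed.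

Fact end_add0 : left_id end_zero end_add.
Proof. by move=> f; apply: endP => x /=; rewrite add0r. Qed.

Fact end_addN : left_inverse end_zero end_opp end_add.
Proof. by move=> f; apply: endP => x /=; rewrite addNr. Qed.

HB.instance Definition _ :=
  GRing.isZmodule.Build (endomorphism V) end_addA end_addC end_add0 end_addN.

Fact end_mulA : associative end_mul.
Proof. by move=> f g h; apply: endP. Qed.

Fact end_mul1 : left_id end_one end_mul.
Proof. by move=> f; apply: endP. Qed.

Fact end_1mul : right_id end_one end_mul.
Proof. by move=> f; apply: endP. Qed.

Fact end_mulDl : left_distributive end_mul +%R.
Proof. by move=> f g h; apply: endP. Qed.

Fact end_mulDr : right_distributive end_mul +%R.
Proof. by move=> f g h; apply: endP => x /=; rewrite (svalP f). Qed.

HB.instance Definition _ := GRing.Zmodule_isPzRing.Build (endomorphism V)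
  end_mulA end_mul1 end_1mul end_mulDl end_mulDr.

(** A separate name gives the scalar action a head constant to which the canonical structure can be
    attached. *)
Definition end_module : Type := V.
HB.instance Definition _ := GRing.Zmodule.on end_module.

Fact end_scaleA f g (v : end_module) :
  sval f (sval g v) = sval (f * g) v.
Proof. by []. Qed.

Fact end_scale1 : left_id 1 (fun f (v : end_module) => sval f v : end_module).
Proof. by []. Qed.

Fact end_scaleDr :
  right_distributive (fun f (v : end_module) => sval f v : end_module) +%R.
Proof. by move=> f x y; rewrite (svalP f). Qed.

Fact end_scaleDl (v : end_module) :
  {morph (fun f => sval f v : end_module) : f g / f + g}.
Proof. by []. Qed.

HB.instance Definition _ := GRing.Zmodule_isLmodule.Build (endomorphism V)
  end_module end_scaleA end_scale1 end_scaleDr end_scaleDl.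

End EndomorphismRing.

(** * Mal'cev operations that commute with themselves, and their groups *)

Record entropic_malcev := EntropicMalcev {
  em_type :> Type;
  em : em_type -> em_type -> em_type -> em_type;
  em_zero : em_type;
  em_left : forall x y, em x x y = y;
  em_right : forall x y, em y x x = y;
  em_entropic : forall a b c d e f g h i,
    em (em a b c) (em d e f) (em g h i) = em (em a d g) (em b e h) (em c f i) }.

Definition em_group (T : entropic_malcev) : Type := em_type T.

Section EntropicGroup.
Variable T : entropic_malcev.
Local Notation o := (@em_zero T).
Local Notation m := (@em T).

HB.instance Definition _ := gen_eqMixin (em_group T).
HB.instance Definition _ := gen_choiceMixin (em_group T).

(** This law, commutativity and the inverse law are each the entropic identity for one 3x3 matrix
    with most entries [o]. *)
Fact em_addA : associative (fun x y => m x o y).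
Proof.
move=> x y z; have := em_entropic x o o o o o y o z.
by rewrite !em_left !em_right.
Qed.

Fact em_addC : commutative (fun x y => m x o y).
Proof.
move=> x y; have := em_entropic o o x o o o y o o.
by rewrite !em_left !em_right.
Qed.

Fact em_add0 : left_id o (fun x y => m x o y).
Proof. by move=> x; rewrite em_left. Qed.

Fact em_addN : left_inverse o (fun x => m o x o) (fun x y => m x o y).
Proof.
move=> x; have := em_entropic o x o o o o o o x.
by rewrite !em_left !em_right.
Qed.

HB.instance Definition _ := GRing.isZmodule.Build (em_group T)
  em_addA em_addC em_add0 em_addN.

(** After adding [y] to both sides it remains to see that [m x y z + y = x + z]. This is the
    entropic law for the rows [x y z], [o o o] and [o (-y) o]: the last row evaluates to [y], the
    middle column to [o]. *)
Lemma emE (x y z : em_group T) : m x y z = (x - y + z :> em_group T)%R.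
Proof.
apply: (@GRing.addIr _ y); rewrite GRing.addrAC GRing.subrK.
have := em_entropic x y z o o o o (m o y o) o.
have <- : (- (- y))%R = m o (m o y o) o by [].
rewrite GRing.opprK => E.
move: E; rewrite !em_right => E.
transitivity (m (m x y z) o y : em_group T); first by [].
rewrite E; congr (m _ _ _).
exact: (@GRing.addrN (em_group T) y).
Qed.

End EntropicGroup.

(** * Mal'cev terms; an algebra whose Mal'cev term is a homomorphism is abelian *)

Section MalcevTerm.
Variables (sg : signature) (t : term sg 'I_3).
Implicit Types P Q : algebra sg.

Definition mal P (x y z : P) : P := Defs.eval (tnth [tuple x; y; z]) t.

Definition malcev_on P := forall x y : P, mal x x y = y /\ mal y x x = y.

Lemma mal_hom P Q (h : P -> Q) x y z :
  is_hom h -> h (mal x y z) = mal (h x) (h y) (h z).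
Proof.
move=> hh; rewrite /mal hom_eval //; congr Defs.eval; apply/funext => i /=.
by case: i => -[|[|[|//]]] ?.
Qed.

Lemma mal_power (I : Type) P (x y z : power P I) (i : I) :
  mal x y z i = mal (x i) (y i) (z i).
Proof. by rewrite (mal_hom (h := fun f : power P I => f i)). Qed.

Lemma malcev_separated P Q : malcev_on Q ->
  (forall x y : P, (forall h : P -> Q, is_hom h -> h x = h y) -> x = y) ->
  malcev_on P.
Proof.
move=> mQ sep x y; split; apply: sep => h hh; rewrite mal_hom //.
  by rewrite (mQ (h x) (h y)).1.
by rewrite (mQ (h x) (h y)).2.
Qed.

Lemma malcev_power (I : Type) P : malcev_on P -> malcev_on (power P I).
Proof.
move=> mP x y; split; apply/functional_extensionality_dep => i; rewrite mal_power.
  by rewrite (mP _ _).1.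
by rewrite (mP _ _).2.
Qed.

Definition compatible P (R : P -> P -> Prop) :=
  forall (o : sg) (v w : 'I_(arity o) -> P),
    (forall i, R (v i) (w i)) -> R (op o v) (op o w).

Lemma mal_compatible P (R : P -> P -> Prop) (x y z x' y' z' : P) :
  compatible R -> R x x' -> R y y' -> R z z' -> R (mal x y z) (mal x' y' z').
Proof.
move=> Rc xx yy zz; rewrite /mal.
have : forall i, R (tnth [tuple x; y; z] i) (tnth [tuple x'; y'; z'] i).
  by case=> -[|[|[|//]]] ?.
move: (tnth _) (tnth _) => r r' rr'; elim: t => [v|o ts IH] /=; first exact: rr'.
exact: Rc.
Qed.

(** The term induces the group operation [x - y + z]. Each basic operation commutes with it, so
    minus its constant it is additive and splits into the sum of its restrictions to single
    coordinates, which are endomorphisms. *)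
Lemma entropic_abelian (A : algebra sg) : malcev_on A ->
  (forall (o : sg) (u v w : 'I_(arity o) -> A),
     mal (op o u) (op o v) (op o w) = op o (fun i => mal (u i) (v i) (w i))) ->
  abelian A.
Proof.
move=> mA mop.
(* As a homomorphism from the cube, [mal] commutes with every term, in particular with itself; this
   is the entropic law [ent]. *)
pose H (f : power A 'I_3) := mal (f ord0) (f (inord 1)) (f ord_max).
have hH : is_hom H by move=> o v; rewrite /H -mop.
pose tri (x y z : A) : power A 'I_3 := tnth [tuple x; y; z].
have H3 x y z : H (tri x y z) = mal x y z.
  by rewrite /H /tri /tnth /= inordK.
have ent a b c d e f g h i :
    mal (mal a b c) (mal d e f) (mal g h i) =
    mal (mal a d g) (mal b e h) (mal c f i) :> A.
  have := mal_hom (tri a d g) (tri b e h) (tri c f i) hH.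
  rewrite !H3 => <-; rewrite /H !mal_power /tri /tnth /= inordK //.
have [a0] := algebra_nonempty A.
pose T := EntropicMalcev a0 (fun x y => (mA x y).1) (fun x y => (mA x y).2) ent.
pose V : zmodType := em_group T.
exists (endomorphism V), (end_module V), id.
split; first by exists id.
move=> o; pose n := arity o; pose c : V := op o (fun=> a0).
pose D (v : 'I_n -> V) : V := ((op o v : V) - c)%R.
have DD v w : D (fun i => v i + w i)%R = (D v + D w)%R.
  (* With the middle argument at the zero [a0], the hypothesis reads
     [op (v + w) = op v - c + op w]. *)
  have /(congr1 (fun x : V => x - c)%R) := esym (mop o v (fun=> a0) w).
  by rewrite -[mal (op o v) _ _]/(@em T _ _ _) emE -GRing.addrA.
pose dl (i : 'I_n) (x : V) : 'I_n -> V := fun j => if j == i then x else 0%R.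
have rP i : {morph (fun x => D (dl i x)) : x y / (x + y)%R}.
  move=> x y; rewrite -DD; congr D; apply/funext => j; rewrite /dl.
  by case: eqP => // _; rewrite GRing.addr0.
exists (fun i => exist (fun f : V -> V => {morph f : x y / (x + y)%R}) _ (rP i)), c => v.
have D0 : D (fun=> 0%R) = 0%R by rewrite /D GRing.subrr.
pose w : 'I_n -> V := v.
suff E (s : seq 'I_n) : uniq s ->
    D (fun j => if j \in s then w j else 0%R) = (\sum_(i <- s) D (dl i (w i)))%R.
  have := E (index_enum 'I_n) (index_enum_uniq _) => /=.
  have -> : (fun j => if j \in index_enum 'I_n then w j else 0%R) = w.
    by apply/funext => j; rewrite mem_index_enum.
  by move=> Dw; rewrite -[LHS](GRing.subrK c) -/(D w) Dw.
elim: s => [_|i s IH /= /andP[is_ us]]; first by rewrite big_nil.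
rewrite big_cons -IH // -DD; congr D; apply/funext => j.
rewrite /dl in_cons; case: eqP => [->|_] /=; last by rewrite GRing.add0r.
by rewrite (negPf is_) GRing.addr0.
Qed.

End MalcevTerm.

(** * Finite sets and distinct representatives *)

Lemma finite_type_enum (T : Type) : finite_set [set: T] ->
  exists m (en : 'I_m -> T) (rk : T -> 'I_m), cancel en rk /\ cancel rk en.
Proof.
move=> /finite_set_enum[n [u uT]].
have /choice[r rP] t : exists i, u i = t by have [i _ it] := uT t I; exists i.
(* Repetitions of [u] are dropped by keeping the one index that [r] selects for each element. *)
pose s := [seq i <- enum 'I_n | r (u i) == i].
have rs t : r t \in s by rewrite mem_filter rP eqxx mem_enum.
exists (size s), (fun i => u (tnth (in_tuple s) i)).
have ilt t : (index (r t) s < size s)%N by rewrite index_mem.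
exists (fun t => Ordinal (ilt t)); split=> [i|t]; last first.
  by rewrite (tnth_nth (r t)) /= nth_index.
apply: val_inj => /=; have : tnth (in_tuple s) i \in s by exact: mem_tnth.
rewrite mem_filter => /andP[/eqP -> _].
by rewrite (tnth_nth (tnth (in_tuple s) i)) /= index_uniq // filter_uniq // enum_uniq.
Qed.

Lemma finite_injective_bijective (T : Type) (f : T -> T) :
  finite_set [set: T] -> injective f -> bijective f.
Proof.
move=> /finite_type_enum[m [en [rk [enK rkK]]]] fi.
have /injF_bij[g gK Kg] : injective (rk \o f \o en).
  by apply: inj_comp (can_inj enK); apply: inj_comp (can_inj rkK) fi.
exists (en \o g \o rk) => x /=; last first.
  by apply: (can_inj rkK); have := Kg (rk x).
by have := gK (rk x); rewrite /= rkK => ->; rewrite rkK.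
Qed.

(** A greedy choice: fewer than [n] elements are ever taken, so no set is exhausted. *)
Lemma distinct_representatives (Z : finType) n (S : 'I_n -> {set Z}) :
  (forall j, (n <= #|S j|)%N) ->
  exists T : 'I_n -> Z, injective T /\ forall j, T j \in S j.
Proof.
elim: n S => [|n IH] S Sn.
  by exists (fun i : 'I_0 => match notF (ltn_ord i) with end); split=> -[].
have [|T [Ti TS]] := IH (fun j => S (lift ord0 j)); first by move=> j; exact: ltnW.
have [t /[!inE]/andP[tT tS]] : exists t, t \in S ord0 :\: [set T j | j in 'I_n].
  apply/set0Pn; rewrite -card_gt0 cardsD subn_gt0.
  apply: leq_trans (Sn ord0); rewrite ltnS.
  apply: leq_trans (subset_leq_card (subsetIr _ _)) _.
  by rewrite (leq_trans (leq_imset_card _ _)) // card_ord.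
exists (fun i => if unlift ord0 i is Some j then T j else t); split.
  move=> i i'; case: unliftP => [j|] ->; case: unliftP => [j'|] -> //.
  - by move=> /Ti ->.
  - by move=> E; case/negP: tT; apply/imsetP; exists j.
  - by move=> E; case/negP: tT; apply/imsetP; exists j'.
by move=> j; case: unliftP => [j'|] ->.
Qed.

(** * Kernels of homomorphisms onto a finite simple non-abelian Mal'cev algebra *)

Section SimpleMalcev.
Variables (sg : signature) (A : algebra sg) (t : term sg 'I_3).
Hypotheses (A_finite : finite_set [set: A]) (A_simple : simple A).
Hypotheses (mA : malcev_on t A) (nabA : ~ abelian A).

(** In a Mal'cev algebra a reflexive compatible relation is automatically symmetric and transitive,
    so simplicity applies to it. *)
Lemma compatible_full (R : A -> A -> Prop) : compatible R ->
  (forall x, R x x) -> (exists x y, R x y /\ x <> y) -> forall x y, R x y.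
Proof.
move=> Rc Rr [x [y [xy nxy]]].
have Rs a b : R a b -> R b a.
  move=> ab; have := mal_compatible t Rc (Rr a) ab (Rr b).
  by rewrite (mA _ _).1 (mA _ _).2.
have Rt b a c : R a b -> R b c -> R a c.
  move=> ab bc; have := mal_compatible t Rc ab (Rr b) bc.
  by rewrite (mA _ _).1 (mA _ _).2.
have [/(_ x y xy)//|] := A_simple.2 (Congruence Rr Rs Rt Rc).
exact.
Qed.

Section Kernels.
Variables (F : algebra sg) (h : F -> A).
Hypotheses (mF : malcev_on t F) (hh : is_hom h) (hs : forall a, exists f, h f = a).

(** The image of [N] under [h] is compatible, reflexive since [h] is onto, and not the equality. *)
Lemma image_full (N : congruence F) :
  (exists f f', N f f' /\ h f <> h f') ->
  forall x y, exists f f', [/\ N f f', h f = x & h f' = y].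
Proof.
move=> [f [f' [Nff ff]]]; apply: compatible_full.
- move=> o v w vw; have /choice[u] := vw => /choice[u' uu].
  exists (op o u), (op o u'); split.
  + by apply: cong_op => i; have [] := uu i.
  + by rewrite hh; congr op; apply/funext => i; have [] := uu i.
  + by rewrite hh; congr op; apply/funext => i; have [] := uu i.
- by move=> x; have [g <-] := hs x; exists g, g; split=> //; exact: cong_refl.
- by exists (h f), (h f'); split=> //; exists f, f'.
Qed.

(* If both conclusions fail, every (x, y, z) is part of the h-image of a 2x2
   matrix over F with N1-related rows and N2-related columns; its fourth entry
   must be mal x y z, so that mal is a homomorphism. *)
Lemma kernel_prime (N1 N2 : congruence F) :
  (forall f f', N1 f f' -> N2 f f' -> h f = h f') ->
  (forall f f', N1 f f' -> h f = h f') \/ (forall f f', N2 f f' -> h f = h f').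
Proof.
move=> N12; apply: contrapT => /not_orP[/existsNP[f1 /existsNP[f2 /not_implyP fN]]].
move=> /existsNP[g1 /existsNP[g2 /not_implyP gN]].
have full1 := image_full (ex_intro _ f1 (ex_intro _ f2 fN)).
have full2 := image_full (ex_intro _ g1 (ex_intro _ g2 gN)).
have mc (N : congruence F) := @mal_compatible sg t F N _ _ _ _ _ _ (@cong_op _ _ N).
have mat x y z : exists M : F * F * (F * F),
    [/\ N1 M.1.1 M.1.2, N1 M.2.1 M.2.2, N2 M.1.1 M.2.1 & N2 M.1.2 M.2.2] /\
    [/\ h M.1.1 = x, h M.1.2 = y, h M.2.1 = mal t x y z & h M.2.2 = z].
  have [u [v [uv hu hv]]] := full1 x y.
  have [v' [w [vw hv' hw]]] := full2 y z.
  have [c hc] := hs y.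
  (* Along a row only [u] changes to [v], along a column only [v'] to [w]. Since [c], [v] and [v']
     all lie over [y], the Mal'cev identities give the three prescribed values. *)
  exists ((mal t u c v', mal t v c v'), (mal t u c w, mal t v c w)) => /=.
  split; split.
  - by apply: mc => //; exact: cong_refl.
  - by apply: mc => //; exact: cong_refl.
  - by apply: mc => //; exact: cong_refl.
  - by apply: mc => //; exact: cong_refl.
  - by rewrite mal_hom // hu hc hv' (mA _ _).2.
  - by rewrite mal_hom // hv hc hv' (mA _ _).2.
  - by rewrite mal_hom // hu hc hw.
  - by rewrite mal_hom // hv hc hw (mA _ _).1.
apply: nabA; apply: (entropic_abelian mA) => o u v w.
have /choice[M MP] i := mat (u i) (v i) (w i).
pose F1 := op o (fun i => (M i).1.1); pose F2 := op o (fun i => (M i).1.2).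
pose F3 := op o (fun i => (M i).2.1); pose F4 := op o (fun i => (M i).2.2).
have h1 : h F1 = op o u by rewrite hh; congr op; apply/funext => i; have [_ []] := MP i.
have h2 : h F2 = op o v by rewrite hh; congr op; apply/funext => i; have [_ []] := MP i.
have h4 : h F4 = op o w by rewrite hh; congr op; apply/funext => i; have [_ []] := MP i.
have h3 : h F3 = op o (fun i => mal t (u i) (v i) (w i)).
  by rewrite hh; congr op; apply/funext => i; have [_ []] := MP i.
have N1_12 : N1 F1 F2 by apply: cong_op => i; have [[]] := MP i.
have N1_34 : N1 F3 F4 by apply: cong_op => i; have [[]] := MP i.
have N2_13 : N2 F1 F3 by apply: cong_op => i; have [[]] := MP i.
have N2_24 : N2 F2 F4 by apply: cong_op => i; have [[]] := MP i.
(* Modulo [N1], [mal F1 F2 F4] equals [mal F2 F2 F4 = F4], hence [F3]. Modulo [N2] it equals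
   [mal F1 F2 F2 = F1], hence again [F3]. *)
rewrite -h1 -h2 -h4 -h3 -mal_hom //; apply: N12.
  apply: cong_trans (cong_sym N1_34); rewrite -[F4 in X in N1 _ X](mF F2 F4).1.
  by apply: mc => //; exact: cong_refl.
apply: cong_trans N2_13; rewrite -[F1 in X in N2 _ X](mF F2 F1).2.
by apply: mc; [exact: cong_refl|exact: cong_refl|exact: cong_sym].
Qed.

Section Families.
Variables (I : eqType) (k : I -> F -> A).
Hypothesis hk : forall i, is_hom (k i).

Lemma agree_op (s : seq I) : compatible (fun f f' : F =>
  forall i, i \in s -> k i f = k i f').
Proof.
move=> o v w vw i si; rewrite !hk; congr op; apply/funext => j /=.
exact: vw.
Qed.

Definition agree (s : seq I) : congruence F := @Congruence sg F
  (fun f f' => forall i, i \in s -> k i f = k i f')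
  (fun f i _ => erefl) (fun f f' ff i si => esym (ff i si))
  (fun f f' f'' ff ff' i si => etrans (ff i si) (ff' i si))
  (@agree_op s).

(** Primeness iterated along [s]; the empty list is excluded because [h] would be constant, while
    [A] has two elements. *)
Lemma kernel_prime_family (s : seq I) :
  (forall f f', (forall i, i \in s -> k i f = k i f') -> h f = h f') ->
  exists2 i, i \in s & forall f f', k i f = k i f' -> h f = h f'.
Proof.
elim: s => [|i s IH] ks.
  have [[a [b ab]] _] := A_simple; case: ab.
  have [f <-] := hs a; have [f' <-] := hs b; exact: ks.
have [|H|/IH[j js jP]] := @kernel_prime (agree [:: i]) (agree s).
- move=> f f' /= fi fs; apply: ks => j; rewrite in_cons => /orP[/eqP ->|/fs//].
  by apply: fi; rewrite mem_head.
- exists i; first exact: mem_head.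
  by move=> f f' ff; apply: H => j; rewrite inE => /eqP ->.
- by exists j => //; rewrite in_cons js orbT.
Qed.

(** A Chinese remainder statement: by primeness the common kernel of the [k i] is not below that of
    [h], so its image under [h] is full. *)
Lemma independent_kernel (s : seq I) :
  (forall i, i \in s -> exists f f', k i f = k i f' /\ h f <> h f') ->
  forall f a, exists f', (forall i, i \in s -> k i f' = k i f) /\ h f' = a.
Proof.
move=> ks f a.
have [|f1 [f2 [N12 h1 h2]]] := @image_full (agree s) _ (h f) a.
  apply: contrapT => /forallNP nE.
  have [|i si iP] := @kernel_prime_family s.
    by move=> g g' gg; apply: contrapT => ngg; apply: (nE g); exists g'.
  by have [g [g' [/iP]]] := ks i si.
(* Under each [k i] the elements [f1] and [f2] cancel and [f] remains; under [h] the elements [f]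
   and [f1] cancel and [a] remains. *)
exists (mal t f f1 f2); split; last by rewrite mal_hom // h1 h2 (mA _ _).1.
by move=> i si; rewrite mal_hom // (N12 i si) (mA _ _).2.
Qed.

End Families.

(** For a section [s] of [h] the map [h' \o s] is injective, hence bijective as [A] is finite; its
    inverse is the automorphism. *)
Lemma kernel_sub_aut (h' : F -> A) : is_hom h' ->
  (forall f f', h' f = h' f' -> h f = h f') ->
  exists al : A -> A, is_iso al /\ forall f, h f = al (h' f).
Proof.
move=> hh' ker; have /choice[s sP] := hs.
have si : injective (h' \o s) by move=> a b /ker; rewrite !sP.
have [be sK Ks] := finite_injective_bijective A_finite si.
have hE f : h f = be (h' f).
  by rewrite -[be _]sP; apply: ker; have := Ks (h' f).
exists be; split=> //; split; last by exists (h' \o s).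
move=> o v; rewrite -[in LHS](_ : h' (op o (s \o be \o v)) = op o v).
  by rewrite -hE hh; congr op; apply/funext => i /=; rewrite sP.
by rewrite hh'; congr op; apply/funext => i; exact: Ks.
Qed.

End Kernels.

Lemma iso_id (B : algebra sg) : is_iso (@id B).
Proof. by split; [exact: (embedding_id B).1|exists id]. Qed.

Lemma iso_comp (B C D : algebra sg) (f : B -> C) (g : C -> D) :
  is_iso f -> is_iso g -> is_iso (g \o f).
Proof. by move=> [hf bf] [hg bg]; split; [exact: hom_comp|exact: bij_comp]. Qed.

(** * Homomorphisms from finite powers of A to A *)

Definition update (Z : eqType) (f : Z -> A) (z : Z) (a : A) : Z -> A :=
  fun z' => if z' == z then a else f z'.

Section PowerHom.
Variables (Z : finType) (h : power A Z -> A).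
Hypothesis hh : is_hom h.

(** The Mal'cev term transports a change at [z] from one background to another: off [z] the two
    copies of [g] cancel. *)
Lemma update_shift (f g : power A Z) z a a' :
  h (update g z a) = h (update g z a') -> h (update f z a) = h (update f z a').
Proof.
move=> gg; have mPw := malcev_power (I := Z) mA.
have -> : update f z a' = mal t (update f z a : power A Z) (update g z a) (update g z a').
  apply/funext => z'; rewrite mal_power /update; case: eqP => _.
    by rewrite (mA _ _).1.
  by rewrite (mA _ _).2.
by rewrite mal_hom // -gg (mA _ _).2.
Qed.

(** Indistinguishability at [z] over all backgrounds is a congruence of [A]. It is not full, so by
    simplicity it is equality. *)
Lemma update_injective z f a a' : h (update f z a) <> h (update f z a') ->
  forall g, injective (fun b => h (update g z b)).
Proof.
move=> faa.
pose R b b' := forall g, h (update g z b) = h (update g z b').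
have Rop : compatible R.
  move=> o v w vw g.
  have E u : op o (fun i => update g z (u i) : power A Z) =
      update (op o (fun=> g : power A Z)) z (op o u).
    apply/funext => z' /=; rewrite /product_op /update; case: eqP => // _.
  apply: (@update_shift _ (op o (fun=> g : power A Z))).
  rewrite -!E !hh; congr op; apply/funext => i /=; exact: vw.
pose th := @Congruence sg A R (fun b g => erefl) (fun b b' bb g => esym (bb g))
  (fun b c d bc cd g => etrans (bc g) (cd g)) Rop.
have [H|H] := A_simple.2 th; last by case: faa; exact: H.
by move=> g b b' bb; apply: H => g'; exact: update_shift bb.
Qed.

(** If [h] depends on some coordinate, it is injective in it, hence onto. The coordinate kernels
    meet in equality, so by primeness one of them lies below the kernel of [h]. *)
Lemma power_hom :
  (exists e, idempotent_elt e /\ forall f, h f = e) \/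
  (exists z al, is_iso al /\ forall f, h f = al (f z)).
Proof.
have mPw := malcev_power (I := Z) mA.
case: (pselect (exists z f a a', h (update f z a) <> h (update f z a'))).
  move=> [z [f [a [a' faa]]]]; right.
  have [g gK Kg] := finite_injective_bijective A_finite (update_injective faa (g := f)).
  have hs b : exists f, h f = b by exists (update f z (g b)); exact: Kg.
  have [|z' _ z'P] := kernel_prime_family mPw hh hs
      (k := fun z (f : power A Z) => f z) (s := enum Z) (fun _ _ _ => erefl).
    by move=> u u' uu; congr h; apply/funext => z'; apply: uu; rewrite mem_enum.
  have [//|al [isoal alP]] :=
    kernel_sub_aut hh hs (h' := fun f : power A Z => f z') _ z'P.
  by exists z', al.
move=> /forallNP nE; left.
(* No single coordinate matters, so [f] is turned into [g] one coordinate at a time. *)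
have E f g : h f = h g.
  suff : forall s : seq Z, h (fun z => if z \in s then g z else f z) = h f.
    move=> /(_ (enum Z)) <-; congr h; apply/funext => z; by rewrite mem_enum.
  elim=> [|z s <-]; first by congr h.
  set u := fun z => if z \in s then _ else _.
  rewrite (_ : (fun _ => _) = update u z (g z)); last first.
    by apply/funext => z'; rewrite /update /u in_cons; case: eqP => // ->.
  rewrite [in RHS](_ : u = update u z (u z)); last first.
    by apply/funext => z'; rewrite /update; case: eqP => // ->.
  by apply: contrapT => ne; apply: (nE z); exists u, (g z), (u z).
have [f] := algebra_nonempty (power A Z).
exists (h f); split=> // o v vP.
rewrite /= (_ : v = fun=> h f); last by apply/funext => i; exact: vP.
rewrite -[in RHS](E (op o (fun=> f))) hh //.
Qed.

End PowerHom.

(* A finite piece U of D together with coordinates identifying it with A^Z. *)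
Definition box (D : algebra sg) (Z : finType) (p : Z -> D -> A) (U : set D) :=
  [/\ op_closed U, forall z, is_hom (p z),
    forall d d', U d -> U d' -> (forall z, p z d = p z d') -> d = d' &
    forall f : Z -> A, exists d, U d /\ forall z, p z d = f z].

Lemma box_chart (D : algebra sg) (Z : finType) (p : Z -> D -> A) (U : set D) :
  box p U -> exists c : power A Z -> D,
    [/\ is_embedding c, forall f, U (c f) & forall f z, p z (c f) = f z].
Proof.
move=> [Uc hp pinj psurj].
have /choice[c cP] := psurj; exists c; split=> [||f z]; last exact: (cP f).2.
  split=> [o v|f g fg]; last first.
    by apply/funext => z; rewrite -(cP f).2 -(cP g).2 fg.
  apply: pinj; first exact: (cP _).1.
    by apply: Uc => i; exact: (cP _).1.
  move=> z; rewrite (cP _).2 hp; congr op; apply/funext => i /=.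
  by rewrite (cP _).2.
by move=> f; exact: (cP f).1.
Qed.

(* Atomlessness, seen through homomorphisms to A: a box can be refined so that
   each coordinate, and each constant idempotent, splits into many coordinates. *)
Definition rich (D : algebra sg) := forall (E : set D) (N : nat), finite_set E ->
  exists (Z Z' : finType) (p : Z -> D -> A) (p' : Z' -> D -> A) (U U' : set D),
  [/\ (0 < #|Z|)%N, box p U, box p' U', E `<=` U /\ U `<=` U' &
    forall chi : D -> A,
      (exists z, forall d, U d -> chi d = p z d) \/
      (exists e, idempotent_elt e /\ forall d, U d -> chi d = e) ->
      (N <= #|[set z' | `[<exists al : A -> A, is_iso al /\
                    forall d, U d -> p' z' d = al (chi d)>]]%SET|)%N].

(** * From richness to covering, universality and extension *)

Lemma power_enum (Z : finType) : isomorphic (power A 'I_#|Z|) (power A Z).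
Proof.
exists (fun f z => f (enum_rank z)); split=> //.
exists (fun g i => g (enum_val i)) => f; apply/funext => i.
  by rewrite enum_valK.
by rewrite enum_rankK.
Qed.

Lemma finite_powers_finite P : finite_powers A P -> finite_set [set: P].
Proof.
move=> [k _ ->]; have [m [en [rk [enK rkK]]]] := finite_type_enum A_finite.
apply: (@sub_finite_set _ _ (range (fun f : {ffun 'I_k -> 'I_m} => en \o f))).
  move=> f _; exists [ffun i => rk (f i)] => //; apply/funext => i /=.
  by rewrite ffunE rkK.
exact/finite_image/finite_finset.
Qed.

Lemma rich_covered D : rich D -> covered (finite_powers A) D.
Proof.
move=> richD E /(richD _ 0%N)[Z [Z' [p [p' [U [U' [Z0 bU _ [EU _] _]]]]]]].
have [c [ec cU cP]] := box_chart bU; have [i isoi] := power_enum Z.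
exists (power A 'I_#|Z|), (c \o i); split; first by exists #|Z|.
  by apply: embedding_comp ec; exact: iso_embedding.
have [j [_ ij ji]] := iso_inv isoi.
move=> d /EU Ud; exists (j (fun z => p z d)) => //=; rewrite ji.
by have [_ _ inj _] := bU; apply: inj => // z; rewrite cP.
Qed.

Lemma rich_universal D : rich D -> universal (finite_powers A) D.
Proof.
move=> richD P [[//|k] _ ->].
have [Z [Z' [p [p' [U [U' [Z0 bU bU' _ cnt]]]]]]] := richD _ k.+1 (@finite_set0 D).
have [z _] : exists z, z \in Z by apply/card_gt0P.
have := cnt (p z) (or_introl (ex_intro _ z (fun d _ => erefl))).
move=> /leq_trans/(_ (max_card _)) kZ.
have [c [ec _ _]] := box_chart bU'.
(* Composition with a surjection of index sets embeds the smaller power into the larger one; [inord]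
   sends the surplus ranks to 0. *)
pose s (z : Z') : 'I_k.+1 := inord (enum_rank z).
have ss i : exists z, s z = i.
  have iZ : (i < #|Z'|)%N by exact: leq_trans kZ.
  exists (enum_val (Ordinal iZ)); rewrite /s enum_valK /=.
  by apply: val_inj; rewrite /= inordK.
exists (c \o (fun f : power A 'I_k.+1 => (f \o s) : power A Z')).
apply: embedding_comp ec; split=> // f g fg; apply/funext => i.
by have [z' <-] := ss i; have /(congr1 (@^~ z')) := fg.
Qed.

(** Otherwise no coordinate of the box would see a change at [y], and [phi] would not be
    injective. *)
Lemma box_embedding_dual (D : algebra sg) (Z Y : finType) (p : Z -> D -> A) (U : set D)
    (phi : power A Y -> D) (y : Y) : box p U -> is_embedding phi ->
  (forall f, U (phi f)) ->
  exists z al, is_iso al /\ forall f, p z (phi f) = al (f y).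
Proof.
move=> [_ hp pinj _] ephi phiU; apply: contrapT => nE.
have [[a [b ab]] _] := A_simple.
apply: ab; pose f : power A Y := fun=> a.
have : f = update f y b.
  apply: ephi.2; apply: pinj => // z.
  have [[e [_ eP]]|[y' [al [isoal alP]]]] := power_hom (hom_comp ephi.1 (hp z)).
    by rewrite [LHS]eP [RHS]eP.
  have yy' : y' <> y.
    move=> yy; apply: nE; exists z, al; split=> // g.
    by rewrite -yy; exact: alP.
  by rewrite [LHS]alP [RHS]alP /update; case: eqP.
by move=> /(congr1 (@^~ y)); rewrite /update eqxx.
Qed.

Lemma box_power (Z : finType) : box (fun z (f : power A Z) => f z) setT.
Proof.
split=> // [d d' _ _ dd|f]; first exact/funext.
by exists f.
Qed.

Lemma rich_extensible D : rich D -> extensible (finite_powers A) D.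
Proof.
move=> richD P Q phi mu [k k1 EP] [l l1 EQ]; subst P Q => ephi emu.
have [|Z [Z' [p [p' [U [U' [Z0 bU bU' [EU UU'] cnt]]]]]]] := richD (range phi) l.
  by apply: finite_image; apply: finite_powers_finite; exists k.
have phiU f : U (phi f) by apply: EU; exists f.
have [_ hp' inj' _] := bU'; have [_ hp _ _] := bU.
(* Coordinate [j] of [mu], read on the copy of A^k in [D] and normalized by an automorphism to the
   shape that [rich] can split. *)
have /choice[chi chiP] (j : 'I_l) : exists chi : D -> A,
    ((exists z, forall d, U d -> chi d = p z d) \/
     (exists e, idempotent_elt e /\ forall d, U d -> chi d = e)) /\
    exists be : A -> A, is_iso be /\ forall f, be (mu f j) = chi (phi f).
  have [|[e [eid eP]]|[i [be [isobe beP]]]] := @power_hom _ (fun f => mu f j).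
  - by move=> o v; rewrite emu.1.
  - exists (fun=> e); split; first by right; exists e.
    by exists id; split; [exact: iso_id|exact: eP].
  have [z [al [isoal alP]]] := box_embedding_dual i bU ephi phiU.
  exists (p z); split; first by left; exists z.
  have [be' [isobe' beK _]] := iso_inv isobe.
  exists (al \o be'); split; first exact: iso_comp.
  by move=> f /=; rewrite beP beK alP.
pose S j := [set z' | `[<exists al : A -> A, is_iso al /\
    forall d, U d -> p' z' d = al (chi j d)>]]%SET.
have [T [Ti TP]] := @distinct_representatives _ _ S (fun j => cnt (chi j) (chiP j).1).
(* [ka z] becomes coordinate [z] of the extension. At [T j] it is coordinate [j] up to an
   automorphism, which makes the extension injective. At any other [z] it only has to agree with
   [phi] on the image of [mu]: a constant, or a coordinate of A^l that detects the relevant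
   coordinate of A^k. *)
have /choice[ka kaP] (z : Z') : exists ka : power A 'I_l -> A, [/\ is_hom ka,
    forall f, ka (mu f) = p' z (phi f) &
    forall j, T j = z -> forall g g', ka g = ka g' -> g j = g' j].
  case: (pselect (exists j, T j = z)) => [[j Tj]|nT].
    have := TP j; rewrite Tj inE => /asboolP[al [isoal alP]].
    have [_ [be [isobe beP]]] := chiP j.
    exists (fun g => al (be (g j))); split.
    - by move=> o v; rewrite /= /product_op isobe.1 isoal.1.
    - by move=> f; rewrite alP // beP.
    - move=> j'; rewrite -Tj => /Ti -> g g' /(bij_inj isoal.2).
      exact: (bij_inj isobe.2).
  have nTz j (Tj : T j = z) : False by apply: nT; exists j.
  have [[e [eid eP]]|[i [al [isoal alP]]]] := power_hom (hom_comp ephi.1 (hp' z)).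
    exists (fun=> e); split=> [o v|f|j /nTz//]; last by rewrite [RHS]eP.
    by symmetry; apply: eid.
  have [//|j [be [isobe beP]]] := box_embedding_dual i (box_power 'I_l) emu.
  have [be' [isobe' beK _]] := iso_inv isobe.
  exists (fun g => al (be' (g j))); split=> [o v|f|j' /nTz//].
    by rewrite /= /product_op isobe'.1 isoal.1.
  by rewrite beP beK [RHS]alP.
have [c [ec cU cP]] := box_chart bU'.
exists (fun g => c (fun z => ka z g)); split; first split.
- move=> o v; rewrite -[RHS]ec.1; congr c; apply/funext => z.
  by have [-> _ _] := kaP z.
- move=> g g' /ec.2 gg; apply/funext => j.
  have [_ _ /(_ j erefl)] := kaP (T j); apply.
  by have /(congr1 (@^~ (T j))) := gg.
- move=> f; apply: inj' => // [|z]; first exact: UU'.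
  by rewrite cP; have [_ -> _] := kaP z.
Qed.

End SimpleMalcev.

Lemma eventually_finite (I : finType) (P : I -> nat -> Prop) :
  (forall i, exists n, forall m, (n <= m)%N -> P i m) ->
  exists n, forall i m, (n <= m)%N -> P i m.
Proof.
move=> /choice[f fP]; exists (\max_i f i) => i m mf; apply: fP.
by apply: leq_trans mf; exact: leq_bigmax.
Qed.

(** * Stone spaces: ultrafilters, compactness, and bits of points *)

Section StoneTheory.
Import Order.Theory.
Variables (d : Order.disp_t) (B : ctbDistrLatticeType d).
Local Notation X := (stone_space B).

Lemma filter_sub_ultrafilter (G : set B) :
  is_proper_filter G -> exists x : X, G `<=` stone_set x.
Proof.
move=> fG; pose P (S : set B) := S = set0 \/ (is_proper_filter S /\ G `<=` S).
have GT : G \top%O by case: fG.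
have [|M [PM Mmax]] := @Zorn_bigcup B P.
  move=> F FP tot.
  case: (pselect (exists S, F S /\ S !=set0)) => [[S0 [FS0 S0n]]|nS]; last first.
    left; apply/seteqP; split=> // b [S FS Sb].
    by apply: nS; exists S; split=> //; exists b.
  have FPn S b : F S -> S b -> is_proper_filter S /\ G `<=` S.
    by move=> /FP[->|].
  have [b0 Sb0] := S0n; have [[ST _ _ _] GS] := FPn _ _ FS0 Sb0.
  right; split; last by move=> b Gb; exists S0 => //; exact: GS.
  split.
  - by exists S0.
  - by move=> [S FS Sb]; have [[_ /(_ Sb)]] := FPn _ _ FS Sb.
  - move=> a b [S FS Sa] [S' FS' Sb].
    have [SS|SS] := tot _ _ FS FS'.
      by exists S' => //; have [[_ _ + _] _] := FPn _ _ FS' Sb; apply => //; exact: SS.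
    by exists S => //; have [[_ _ + _] _] := FPn _ _ FS Sa; apply => //; exact: SS.
  - move=> a b ab [S FS Sa]; exists S => //.
    by have [[_ _ _ +] _] := FPn _ _ FS Sa; apply; first exact: ab.
case: PM => [M0|[fM GM]].
  case: (Mmax G); last by right; split.
  by rewrite M0; split=> // /(_ _ GT).
have Mm (G' : set B) : is_proper_filter G' -> M `<=` G' -> G' = M.
  move=> fG' MG'; apply/seteqP; split=> //; apply: contrapT => nG'.
  by case: (Mmax G'); [split|right; split=> // b /GM/MG'].
by exists (StonePoint fM Mm).
Qed.

Lemma stone_top (x : X) : stone_basic \top%O x.
Proof. by case: (stone_filter x). Qed.

Lemma stone_bot (x : X) : ~ stone_basic \bot%O x.
Proof. by case: (stone_filter x). Qed.

Lemma stone_meet (a b : B) (x : X) :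
  stone_basic (a `&` b)%O x <-> stone_basic a x /\ stone_basic b x.
Proof.
have [_ _ xI xS] := stone_filter x; split=> [ab|[xa xb]]; last exact: xI.
by split; apply: xS ab; [exact: leIl|exact: leIr].
Qed.


Lemma stone_compl (a : B) (x : X) : stone_basic (~` a)%O x <-> ~ stone_basic a x.
Proof. by rewrite -stone_basicC. Qed.

Lemma stone_point_exists (b : B) : b <> \bot%O -> exists x : X, stone_basic b x.
Proof.
move=> b0; have [|x bx] := @filter_sub_ultrafilter [set c | (b <= c)%O].
  split=> /=; first exact: lex1.
  - by rewrite lex0 => /eqP.
  - by move=> a c ba bc; rewrite lexI ba bc.
  - by move=> a c ac ba; exact: le_trans ac.
by exists x; apply: bx => /=.
Qed.

Lemma stone_compact (I : set B) :
  (forall x : X, exists b, I b /\ stone_basic b x) ->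
  exists s : seq B, (forall b, b \in s -> I b) /\
    forall x : X, exists2 b, b \in s & stone_basic b x.
Proof.
move=> cov; apply: contrapT => nE.
(* The elements whose complement is finitely covered. Without a finite cover they form a proper
   filter, and an ultrafilter above it avoids every member of [I]. *)
pose G (c : B) := exists s : seq B, (forall b, b \in s -> I b) /\
  forall x : X, ~ stone_basic c x -> exists2 b, b \in s & stone_basic b x.
have [|x Gx] := @filter_sub_ultrafilter G.
  split=> /=.
  - by exists [::]; split=> // x /(_ (stone_top x)).
  - move=> [s [sI sx]]; apply: nE; exists s; split=> // x.
    exact/sx/stone_bot.
  - move=> a c [s [sI sx]] [s' [sI' sx']]; exists (s ++ s'); split.
      by move=> b; rewrite mem_cat => /orP[/sI|/sI'].
    move=> x; rewrite stone_meet => /not_andP[/sx|/sx'] [b bs xb]; exists b => //.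
      by rewrite mem_cat bs.
    by rewrite mem_cat bs orbT.
  - move=> a c ac [s [sI sx]]; exists s; split=> // x nc.
    by apply: sx => xa; apply: nc; have [_ _ _ xS] := stone_filter x; exact: xS ac _.
have [b [Ib xb]] := cov x.
have : stone_basic (~` b)%O x.
  apply: Gx; exists [:: b]; split=> [c|y]; first by rewrite inE => /eqP ->.
  by rewrite stone_compl => /contrapT yb; exists b => //; rewrite mem_head.
by rewrite stone_compl.
Qed.

Hypothesis B_ca : countable_atomless B.

Lemma stone_split (b : B) N : (exists x : X, stone_basic b x) ->
  exists c : 'I_N.+1 -> B, [/\ forall i, exists x : X, stone_basic (c i) x,
    forall x : X, stone_basic b x <-> exists i, stone_basic (c i) x &
    forall (x : X) i j, stone_basic (c i) x -> stone_basic (c j) x -> i = j].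
Proof.
elim: N b => [|N IH] b [x xb].
  exists (fun=> b); split=> [i|y|y i j _ _]; first by exists x.
    by split=> [yb|[]//]; exists ord0.
  by rewrite (ord1 i) (ord1 j).
have b0 : (\bot < b)%O.
  by rewrite lt0x; apply/eqP => E; apply: (@stone_bot x); rewrite -E.
have [_ _ /(_ b b0)[c0 /andP[c00 c0b]]] := B_ca.
have [y yc0] : exists y : X, stone_basic c0 y.
  by apply: stone_point_exists => E; rewrite E ltxx in c00.
have c0Pb (z : X) : stone_basic c0 z -> stone_basic b z.
  by have [_ _ _ zS] := stone_filter z; apply: zS; exact: ltW.
have [|c [cP cb ci]] := IH (b `&` ~` c0)%O.
  apply: stone_point_exists => /eqP; rewrite disj_leC complK => bc0.
  by rewrite (lt_geF c0b) in bc0.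
have cb' z i : stone_basic (c i) z -> stone_basic b z /\ ~ stone_basic c0 z.
  by move=> zc; rewrite -stone_compl -stone_meet cb; exists i.
exists (fun i => if unlift ord0 i is Some j then c j else c0); split.
- by move=> i; case: unliftP => [j|] _; [exact: cP|exists y].
- move=> z; split=> [zb|[i]]; last by case: unliftP => [j|] _; [case/cb'|exact: c0Pb].
  have [zc|zc] := stone_prime z c0; first by exists ord0; rewrite unlift_none.
  have /cb[i zi] : stone_basic (b `&` ~` c0)%O z by rewrite stone_meet.
  by exists (lift ord0 i); rewrite liftK.
- move=> z i j; case: unliftP => [i'|] ->; case: unliftP => [j'|] -> //.
  + by move=> zi zj; rewrite (ci _ _ _ zi zj).
  + by move=> /cb'[_].
  + by move=> zc /cb'[_].
Qed.

Definition bit_enum (en : nat -> B) := forall b, exists i, en i = b.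

Lemma bit_enum_exists : exists en, bit_enum en.
Proof.
have [/countable_injP[f fi] _ _] := B_ca.
have /choice[en enP] (n : nat) : exists b, forall b', f b' = n -> b' = b.
  case: (pselect (exists b, f b = n)) => [[b bn]|nb]; last first.
    by exists \bot%O => b' bn; case: nb; exists b'.
  by exists b => b' bn'; apply: fi; rewrite ?inE // bn.
by exists en => b; exists (f b); symmetry; exact: enP.
Qed.

Section Bits.
Variable en : nat -> B.
Hypothesis enP : bit_enum en.

(** The first [n] digits of [x] in the embedding of the Stone space into Cantor space given by [en];
    their fibres are clopen partitions that refine each other. *)
Definition bits n (x : X) : {ffun 'I_n -> bool} :=
  [ffun i : 'I_n => `[<stone_basic (en i) x>]].

Lemma bitsP n (x y : X) : bits n x = bits n y <->
  forall i, (i < n)%N -> (stone_basic (en i) x <-> stone_basic (en i) y).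
Proof.
split=> [/ffunP xy i lin|xy].
  by have := xy (Ordinal lin); rewrite !ffunE /= => E;
    split=> /asboolP; [rewrite E|rewrite -E] => /asboolP.
by apply/ffunP => i; rewrite !ffunE; apply: asbool_equiv_eq; exact: xy.
Qed.

Lemma bits_le m n (x y : X) : (m <= n)%N -> bits n x = bits n y -> bits m x = bits m y.
Proof.
by move=> mn /bitsP xy; apply/bitsP => i im; apply: xy; exact: leq_trans mn.
Qed.

Lemma bits_bound (s : seq B) : exists n, forall b, b \in s ->
  forall x y, bits n x = bits n y -> (stone_basic b x <-> stone_basic b y).
Proof.
elim: s => [|b s [n nP]]; first by exists 0%N.
have [i bi] := enP b; exists (maxn i.+1 n) => c.
rewrite in_cons => /orP[/eqP ->|cs] x y xy; last first.
  by apply: nP cs _ _ _; apply: bits_le xy; exact: leq_maxr.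
by move/bitsP: xy; rewrite -bi; apply; exact: leq_maxl.
Qed.

Lemma bits_piece n (x : X) : exists b, forall y, stone_basic b y <-> bits n y = bits n x.
Proof.
elim: n => [|n [b bP]].
  exists \top%O => y; split=> _; last exact: stone_top.
  by apply/ffunP => -[].
exists (b `&` (if `[<stone_basic (en n) x>] then en n else ~` en n))%O => y.
rewrite stone_meet bP; split=> [[/bitsP yx yn]|yx].
  apply/bitsP => i; rewrite ltnS leq_eqVlt => /orP[/eqP ->|]; last exact: yx.
  by case: asboolP yn => xn //; rewrite stone_compl.
split; first exact: bits_le yx.
have /bitsP/(_ n (ltnSn n)) ynx := yx.
by case: asboolP; rewrite ?stone_compl ynx.
Qed.

(** By compactness finitely many clopen sets of constancy cover the space, and finitely many bits
    decide membership in all of them. *)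
Lemma locally_constant_bits (T : Type) (f : X -> T) :
  (forall x, exists2 b, stone_basic b x & forall y, stone_basic b y -> f y = f x) ->
  exists n, forall x y, bits n x = bits n y -> f x = f y.
Proof.
move=> fl; pose I (b : B) := forall x y, stone_basic b x -> stone_basic b y -> f x = f y.
have [|s [sI sx]] := @stone_compact I.
  move=> x; have [b xb bf] := fl x; exists b; split=> // y z yb zb.
  by rewrite (bf _ yb) (bf _ zb).
have [n nP] := bits_bound s; exists n => x y xy.
have [b bs xb] := sx x; apply: (sI _ bs) => //.
exact/(nP _ bs _ _ xy).
Qed.

Lemma bits_locally_constant (T : Type) (f : X -> T) n :
  (forall x y, bits n x = bits n y -> f x = f y) ->
  forall x, exists2 b, stone_basic b x & forall y, stone_basic b y -> f y = f x.
Proof.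
move=> fn x; have [b bP] := bits_piece n x; exists b; first exact/bP.
by move=> y /bP; exact: fn.
Qed.

Lemma bits_separate_family N (v : 'I_N -> X) : injective v ->
  exists n, forall m, (n <= m)%N -> injective (bits m \o v).
Proof.
move=> vi.
have [|n nP] := @eventually_finite ('I_N * 'I_N)%type
    (fun ij m => bits m (v ij.1) = bits m (v ij.2) -> ij.1 = ij.2).
  move=> [i j] /=; case: (pselect (v i = v j)) => [/vi ij|vij]; first by exists 0%N.
  have [b [bi bj]] := stone_separation vij; have [n nP] := bits_bound [:: b].
  exists n => m nm vm; case: bj; apply/(nP b (mem_head _ _) (v i)) => //.
  exact: bits_le vm.
by exists n => m nm i j; exact: (nP (i, j) m nm).
Qed.

(** Atomlessness enters here: a piece is never reduced to finitely many points. *)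
Lemma bits_grow n (y : X) N : exists v : 'I_N -> X,
  injective v /\ forall i, bits n (v i) = bits n y.
Proof.
have [b bP] := bits_piece n y.
have [|c [cP cb ci]] := @stone_split b N; first by exists y; exact/bP.
have /choice[v vP] := cP.
exists (fun i => v (widen_ord (leqnSn N) i)); split=> [i j vij|i].
  have := ci _ _ _ (vP (widen_ord (leqnSn N) i)); rewrite vij => /(_ _ (vP _)).
  by move=> /(congr1 val) /= ij; exact: val_inj.
by apply/bP/cb; exists (widen_ord (leqnSn N) i).
Qed.

(** * The filtered Boolean power is rich and countable *)

Section FilteredPower.
Variables (sg : signature) (A : algebra sg).
Hypotheses (A_finite : finite_set [set: A]).
Variables (r : nat) (e : 'I_r -> A) (x : 'I_r -> X).
Hypothesis (e_idem : forall i, idempotent_elt (e i)).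
Hypothesis (e_all : forall a : A, idempotent_elt a -> exists i, a = e i).
Hypothesis x_inj : injective x.

Local Notation D := (filtered_boolean_power e_idem x_inj).

Definition value (f : D) (y : X) : A := sval (sval f) y.

Lemma value_inj (f g : D) : (forall y, value f y = value g y) -> f = g.
Proof. by move=> fg; apply: sval_inj; apply: sval_inj; apply/funext. Qed.

Lemma value_point (f : D) i : value f (x i) = e i.
Proof. exact: (svalP f). Qed.

Definition bit_level n : set D := [set f |
  forall y z, bits n y = bits n z -> value f y = value f z].

Lemma value_bits (f : D) : exists n, bit_level n f.
Proof.
by apply: locally_constant_bits => y; have /continuous_functionsP := svalP (sval f).
Qed.

Lemma bit_level_le m n : (m <= n)%N -> bit_level m `<=` bit_level n.
Proof. by move=> mn f fm y z /(bits_le mn); exact: fm. Qed.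

Lemma bit_level_fun n (f : X -> A) :
  (forall y z, bits n y = bits n z -> f y = f z) -> (forall i, f (x i) = e i) ->
  exists g : D, forall y, value g y = f y.
Proof.
move=> fn fx; have cf : continuous_functions (f : power A X).
  by apply/continuous_functionsP; exact: bits_locally_constant fn.
by exists (exist _ (exist _ _ cf) fx).
Qed.

(** Patterns of prescribed points are left out because there the value of an element constant on
    pieces is forced. *)
Definition free_piece n : pred {ffun 'I_n -> bool} := fun w =>
  `[<exists y, bits n y = w>] && [forall i, w != bits n (x i)].

Definition piece n := {w : {ffun 'I_n -> bool} | free_piece w}.

Lemma piece_point_exists n (z : piece n) : exists y, bits n y = val z.
Proof. by have /andP[/asboolP] := valP z. Qed.

Definition piece_point n (z : piece n) : X := sval (cid (piece_point_exists z)).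

Lemma piece_pointP n (z : piece n) : bits n (piece_point z) = val z.
Proof. by rewrite /piece_point; case: cid. Qed.

Lemma piece_cases n (y : X) : (exists i, bits n y = bits n (x i)) \/
  (exists z : piece n, bits n y = val z).
Proof.
case: (pselect (exists i, bits n y = bits n (x i))) => [|nx]; first by left.
right; have yP : free_piece (bits n y).
  apply/andP; split; first by apply/asboolP; exists y.
  by apply/forallP => i; apply/eqP => yi; apply: nx; exists i.
by exists (exist (fun w => free_piece w) _ yP).
Qed.

Lemma bit_level_box n : injective (bits n \o x) ->
  box (fun (z : piece n) (f : D) => value f (piece_point z)) (bit_level n).
Proof.
move=> sepn; split.
- move=> o v vn y z yz; rewrite /value /= /product_op; congr op.
  by apply/funext => i; exact: vn.
- by [].
- move=> f g fn gn fg; apply: value_inj => y.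
  have [[i yi]|[z yz]] := piece_cases n y.
    by rewrite (fn _ _ yi) (gn _ _ yi) !value_point.
  rewrite -piece_pointP in yz.
  by rewrite (fn _ _ yz) (gn _ _ yz).
- move=> f; have [a0] := algebra_nonempty A.
  pose g (w : {ffun 'I_n -> bool}) : A :=
    if [pick i | w == bits n (x i)] is Some i then e i else
    if insub w : option (piece n) is Some z then f z else a0.
  have [||h hP] := @bit_level_fun n (g \o bits n).
  + by move=> y z /= ->.
  + move=> i; rewrite /= /g; case: pickP => [j /eqP/sepn <-//|].
    by move=> /(_ i); rewrite eqxx.
  exists h; split=> [y z yz|z]; first by rewrite !hP /= yz.
  rewrite hP /= piece_pointP /g; case: pickP => [i zi|_]; last by rewrite valK.
  by have /andP[_ /forallP/(_ i)] := valP z; rewrite zi.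
Qed.

Lemma piece_count n (y : X) N : exists n0, forall m, (n0 <= m)%N ->
  (N <= #|[set z : piece m | bits n (piece_point z) == bits n y]%SET|)%N.
Proof.
(* The prescribed points spoil at most [r] patterns; the surplus of [r] points makes up for it. *)
have [v [vi vP]] := bits_grow n y (N + r).
have [n0 sep] := bits_separate_family vi.
exists (maxn n n0) => m; rewrite geq_max => /andP[nm n0m].
pose V := [set bits m (v i) | i in 'I_(N + r)]%SET.
pose W := [set bits m (x j) | j in 'I_r]%SET.
have cV : #|V| = (N + r)%N by rewrite card_imset ?card_ord //; exact: sep.
have cW : (#|W| <= r)%N by rewrite -[r in (_ <= r)%N]card_ord; exact: leq_imset_card.
have NVW : (N <= #|V :\: W|)%N.
  rewrite cardsD leq_subRL; last by rewrite subset_leq_card // subsetIl.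
  rewrite cV addnC leq_add2l (leq_trans _ cW) // subset_leq_card // subsetIr //.
apply: leq_trans NVW _.
set S := [set z : piece m | _]%SET.
suff sVW : V :\: W \subset [set val z | z in S]%SET.
  exact: leq_trans (subset_leq_card sVW) (leq_imset_card _ _).
apply/fintype.subsetP => w; rewrite inE => /andP[wW /imsetP[i _ wi]].
have wP : free_piece w.
  apply/andP; split; first by apply/asboolP; exists (v i).
  apply/forallP => j; apply: contra wW => /eqP ->.
  by apply/imsetP; exists j.
apply/imsetP; exists (exist (fun w => free_piece w) w wP) => //; rewrite inE -(vP i).
by apply/eqP; apply: (bits_le nm); rewrite piece_pointP.
Qed.

Lemma filtered_power_rich : rich A D.
Proof.
move=> E N Efin.
have [|n1 n1P] := directed_finite_set (U := bit_level) (inhabits 0%N) _ value_bits Efin.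
  by move=> i j; exists (maxn i j); split; apply: bit_level_le;
    [exact: leq_maxl|exact: leq_maxr].
have [n2 sep] := bits_separate_family x_inj.
have [y0 _] : exists y : X, stone_basic \top%O y.
  by apply: stone_point_exists; have [_ /eqP T0 _] := B_ca => /esym.
(* With 0 bits all points share one block, so this is a threshold from which some free piece
   exists. *)
have [n3 n3P] := piece_count 0 y0 1.
pose n := maxn n1 (maxn n2 n3).
have [n4 n4P] := eventually_finite (fun z : piece n => piece_count n (piece_point z) N).
have [n5 n5P] := eventually_finite (fun i : 'I_r => piece_count n (x i) N).
pose m := maxn n (maxn n4 n5).
have n2n : (n2 <= n)%N by rewrite !leq_max leqnn orbT.
have n3n : (n3 <= n)%N by rewrite !leq_max leqnn !orbT.
have nm : (n <= m)%N by rewrite leq_maxl.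
have n4m : (n4 <= m)%N by rewrite !leq_max leqnn !orbT.
have n5m : (n5 <= m)%N by rewrite !leq_max leqnn !orbT.
exists (piece n), (piece m), (fun (z : piece n) f => value f (piece_point z)),
  (fun (z : piece m) f => value f (piece_point z)), (bit_level n), (bit_level m).
split.
- exact: leq_trans (n3P n n3n) (max_card _).
- exact: bit_level_box (sep n n2n).
- exact: bit_level_box (sep m (leq_trans n2n nm)).
- split; last exact: bit_level_le.
  by move=> f /n1P; apply: bit_level_le; exact: leq_maxl.
move=> chi chiP.
(* Both kinds of [chi] are evaluations at a point: a point of a free piece, or the prescribed point
   carrying the idempotent. *)
have [y [ym yP]] : exists y, (N <=
    #|[set z : piece m | bits n (piece_point z) == bits n y]%SET|)%N /\
    forall f, bit_level n f -> chi f = value f y.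
  case: chiP => [[z zP]|[a [/e_all[i ->] aP]]].
    by exists (piece_point z); split=> //; exact: n4P.
  exists (x i); split; first exact: n5P.
  by move=> f fn; rewrite aP // value_point.
apply: leq_trans ym _; apply/subset_leq_card/fintype.subsetP => z; rewrite inE => /eqP zy.
rewrite inE; apply/asboolP; exists id; split; first exact: iso_id.
by move=> f fn; rewrite yP //; exact: fn.
Qed.

Lemma filtered_power_countable : countable [set: D].
Proof.
have [m [a [rk [aK rkK]]]] := finite_type_enum A_finite.
have /choice[code codeP] (f : D) :
    exists c : {n : nat & {ffun {ffun 'I_n -> bool} -> 'I_m}},
    forall y, value f y = a (tagged c (bits (tag c) y)).
  have [n fn] := value_bits f; have [y0 _] : exists y : X, stone_basic \top%O y.
    by apply: stone_point_exists; have [_ /eqP T0 _] := B_ca => /esym.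
  have /choice[g gP] (w : {ffun 'I_n -> bool}) :
      exists b, forall y, bits n y = w -> value f y = b.
    case: (pselect (exists y, bits n y = w)) => [[y yw]|ny]; last first.
      by exists (value f y0) => y yw; case: ny; exists y.
    by exists (value f y) => z zw; apply: fn; rewrite yw.
  exists (existT (fun n => {ffun {ffun 'I_n -> bool} -> 'I_m}) n
     [ffun w => rk (g w)]) => y /=.
  by rewrite ffunE rkK; exact: gP.
apply/countable_injP; exists (pickle \o code) => f g _ _ /= /(pcan_inj pickleK) fg.
by apply: value_inj => y; rewrite !codeP fg.
Qed.

End FilteredPower.
End Bits.
End StoneTheory.

(** * Varieties, quotients and free algebras *)

Section Varieties.
Variable sg : signature.
Implicit Types (P Q : algebra sg) (C K : algebra sg -> Prop).

Lemma variety_generated_variety K : is_variety (variety_generated K).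
Proof.
split.
- move=> P Q h hh hs VP C vC KC; have [+ _ _] := vC; apply; [exact: hh|exact: hs|].
  exact: VP.
- by move=> P S VP C vC KC; have [_ + _] := vC; apply; exact: VP.
- by move=> I P VP C vC KC; have [_ _ +] := vC; apply => i; exact: VP.
Qed.

Lemma variety_generated_base K P : K P -> variety_generated K P.
Proof. by move=> KP C _; exact. Qed.

Lemma class_of_hom P (eta : congruence P) : is_hom (class_of eta : P -> quotient eta).
Proof. by move=> o v; symmetry; exact: quotient_opE. Qed.

Lemma class_of_eqP P (eta : congruence P) a b :
  class_of eta a = class_of eta b <-> eta a b.
Proof.
split=> [/(congr1 sval)/seteqP[_ /(_ b)]|ab]; first by apply; exact: cong_refl.
apply: sval_inj; apply/seteqP; split=> c /=; apply: cong_trans => //.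
exact: cong_sym.
Qed.

Lemma class_of_surj P (eta : congruence P) (q : quotient eta) :
  exists a, class_of eta a = q.
Proof. by case: q => q [a qa]; exists a; apply: sval_inj. Qed.

(** The quotient is a homomorphic image of the subalgebra [range J] of [Q]. *)
Lemma quotient_in_variety C P Q (eta : congruence P) (J : P -> Q) :
  is_variety C -> C Q -> is_hom J -> (forall a b, J a = J b -> eta a b) ->
  C (quotient eta).
Proof.
move=> [Ch Cs _] CQ hJ Jeta.
have /choice[k kP] (s : subalgebra (range_sub hJ)) : exists a, J a = sval s.
  by have [a _ aj] := svalP s; exists a.
apply: (Ch _ _ (fun s : subalgebra (range_sub hJ) => class_of eta (k s) : quotient eta)).
- move=> o v; rewrite -class_of_hom; apply/class_of_eqP/Jeta.
  rewrite kP hJ /=; congr op; apply/funext => i /=; by rewrite kP.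
- move=> q; have [a <-] := class_of_surj q.
  have aJ : range J (J a) by exists a.
  by exists (exist _ (J a) aJ); apply/class_of_eqP/Jeta; rewrite kP.
- exact: Cs.
Qed.

Section FreeAlgebra.
Variables (V : algebra sg -> Prop) (F : algebra sg) (X : Type) (g : X -> F).
Hypotheses (V_variety : is_variety V) (F_free : is_free_over V g).

Lemma free_ext P (h h' : F -> P) : V P -> is_hom h -> is_hom h' ->
  (forall i, h (g i) = h' (g i)) -> forall f, h f = h' f.
Proof.
move=> VP hh hh' hg f; have [_ /(_ P (h \o g) VP)[k [_ kP]]] := F_free.
by rewrite -(kP h) // -(kP h') //; split=> // i /=; rewrite hg.
Qed.

Lemma free_hom P (r : X -> P) : V P ->
  exists h : F -> P, is_hom h /\ forall i, h (g i) = r i.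
Proof. by move=> VP; have [_ /(_ P r VP)[k [kP _]]] := F_free; exists k. Qed.

Lemma free_generated (U : set F) : U !=set0 ->
  op_closed U -> (forall i, U (g i)) -> forall f, U f.
Proof.
move=> U0 Uc Ug f; pose S := Subuniverse U0 Uc.
have [VF _] := F_free; have [_ Vs _] := V_variety.
have [k [hk kP]] := @free_hom (subalgebra S) (fun i => exist _ (g i) (Ug i)) (Vs _ _ VF).
have -> : f = sval (k f); last exact: svalP.
apply: (free_ext VF (h := id) (h' := (fun s : subalgebra S => sval s) \o k)) => //.
- exact: hom_comp (sval_embedding _).1.
- by move=> i; rewrite /= kP.
Qed.

(* Equational reasoning without terms: that f and f' get identified by every
   homomorphism says that the equation f = f' holds; closure under quotients
   lifts homomorphisms from F along surjections. *)
Lemma identified_variety (f f' : F) : is_variety (fun P =>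
  V P /\ forall h : F -> P, is_hom h -> h f = h f').
Proof.
have [VH VS VP] := V_variety; split.
- move=> P Q p hp ps [VP' PE]; have VQ := VH _ _ _ hp ps VP'.
  split=> // h hh; have /choice[r rP] i := ps (h (g i)).
  have [k [hk kg]] := free_hom r VP'.
  have hkE := free_ext VQ hh (hom_comp hk hp).
  by rewrite !hkE /= ?(PE k hk) // => i /=; rewrite kg rP.
- move=> P S [VP' PE]; split=> [|h hh]; first exact: VS.
  by apply: sval_inj; have := PE _ (hom_comp hh (sval_embedding S).1).
- move=> I P PP; split=> [|h hh]; first by apply: VP => i; have [] := PP i.
  apply/functional_extensionality_dep => i.
  have [_ /(_ (fun a => h a i))] := PP i; apply=> o v.
  by rewrite hh.
Qed.

End FreeAlgebra.
End Varieties.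

(** * The free algebra as functions of sequences in A *)

Section GeneratedByA.
Variables (sg : signature) (A : algebra sg) (F : algebra sg) (g : nat -> F).
Local Notation V := (variety_generated (fun P => P = A)).
Local Notation W := (variety_generated (proper_subalgebras A)).
Hypothesis F_free : is_free_over V g.

Let V_variety : is_variety V := variety_generated_variety _.
Let VA : V A := variety_generated_base erefl.
Let VF : V F := F_free.1.

Definition evaluation (r : nat -> A) : F -> A := sval (cid (free_hom F_free r VA)).
Local Notation ev := evaluation.

Lemma evaluation_hom r : is_hom (ev r).
Proof. by rewrite /ev; case: cid => h []. Qed.

Lemma evaluation_gen r i : ev r (g i) = r i.
Proof. by rewrite /ev; case: cid => h []. Qed.

Lemma evaluation_unique (h : F -> A) r : is_hom h -> (forall i, h (g i) = r i) ->
  forall f, h f = ev r f.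
Proof.
move=> hh hg; apply: (free_ext F_free VA) => //; first exact: evaluation_hom.
by move=> i; rewrite evaluation_gen.
Qed.

(** An equation that holds in [A] holds throughout the variety, in particular in [F], where the
    identity map is tested. *)
Lemma evaluation_separate f f' : (forall r, ev r f = ev r f') -> f = f'.
Proof.
move=> ff; have vC := identified_variety V_variety F_free f f'.
have [|_ /(_ id (embedding_id F).1)//] := VF vC.
move=> P ->; split=> // h hh.
by rewrite !(evaluation_unique hh (fun=> erefl)).
Qed.

Definition onto (r : nat -> A) := forall a, exists f, ev r f = a.

(** The right-hand side is the kernel of a map into a product of proper subalgebras, namely the
    images of the evaluations that are not onto. So its quotient lies in the smaller variety and
    minimality gives one inclusion. *)
Lemma verbal_congruenceP (theta : congruence F) :
  is_smallest_congruence_with_quotient_in W theta ->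
  forall f f', theta f f' <-> forall r, ~ onto r -> ev r f = ev r f'.
Proof.
move=> [Wth th_min] f f'; split=> [|ff].
  pose R (f f' : F) := forall r, ~ onto r -> ev r f = ev r f'.
  have Rop (o : sg) (v w : 'I_(arity o) -> F) :
      (forall i, R (v i) (w i)) -> R (op o v) (op o w).
    move=> vw r nr; rewrite !evaluation_hom; congr op; apply/funext => i /=.
    exact: vw.
  pose eta := @Congruence sg F R (fun f r _ => erefl)
    (fun f f' ff r nr => esym (ff r nr))
    (fun f f' f'' ff ff' r nr => etrans (ff r nr) (ff' r nr)) Rop.
  apply: (th_min eta) => C vC KC.
  pose J (f : F) : product_algebra (fun r : {r | ~ onto r} =>
      subalgebra (range_sub (@evaluation_hom (sval r)))) :=
    fun r => exist _ (ev (sval r) f) (ex_intro2 _ _ f I erefl).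
  apply: (quotient_in_variety (J := J) vC).
  - have [_ _] := vC; apply=> r; apply: KC; exists (range_sub (@evaluation_hom (sval r))) => //.
    move=> rT; apply: (svalP r) => a.
    have : [set: A] a by []. 
    by rewrite -rT => -[h _ ha]; exists h.
  - move=> o v; apply/functional_extensionality_dep => r; apply: sval_inj => /=.
    exact: evaluation_hom.
  - move=> a b ab r nr.
    have : J a (exist _ r nr) = J b (exist _ r nr) by rewrite ab.
    by move=> /(congr1 sval).
(* Conversely the equation [f = f'] holds in all proper subalgebras, hence in the quotient by
   [theta], where the projection identifies the two. *)
have vC := identified_variety V_variety F_free f f'.
apply/class_of_eqP; have [|_] := Wth _ vC; last by apply; exact: class_of_hom.
move=> P [S ST ->]; split; first by have [_ + _] := V_variety; apply.
move=> h hh; apply: sval_inj.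
have hh' := hom_comp hh (sval_embedding S).1.
have E k := evaluation_unique hh' (fun=> erefl) k.
rewrite /= in E; rewrite !E; apply: ff => on; apply: ST; apply/seteqP; split=> // a _.
by have [k <-] := on a; rewrite -E; exact: svalP.
Qed.

Lemma truncation_exists n : exists h : F -> F,
  is_hom h /\ forall i, h (g i) = g (minn i n).
Proof. exact: (free_hom F_free (fun i => g (minn i n)) VF). Qed.

(* A retraction of F onto the subalgebra generated by g 0, ..., g n. *)
Definition truncation n : F -> F := sval (cid (truncation_exists n)).
Local Notation tr := truncation.

Lemma truncation_hom n : is_hom (tr n).
Proof. by rewrite /tr; case: cid => h []. Qed.

Lemma truncation_gen n i : tr n (g i) = g (minn i n).
Proof. by rewrite /tr; case: cid => h []. Qed.

Definition level n : set F := [set f | tr n f = f].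

Lemma level_op_closed n : op_closed (level n).
Proof.
move=> o v vn; rewrite /level /= truncation_hom; congr op.
by apply/funext => i; exact: vn.
Qed.

Lemma truncation_le m n f : (m <= n)%N -> tr n (tr m f) = tr m f.
Proof.
move=> mn; apply: (free_ext F_free VF (h := tr n \o tr m)).
- by apply: hom_comp; exact: truncation_hom.
- exact: truncation_hom.
- by move=> i; rewrite /= !truncation_gen -minnA (minn_idPl mn).
Qed.

Lemma truncation_level n f : level n (tr n f).
Proof. exact: truncation_le. Qed.

Lemma level_le m n : (m <= n)%N -> level m `<=` level n.
Proof. by move=> mn f fm; rewrite /level /= -fm truncation_le. Qed.

Lemma level_dir i j : exists k, level i `<=` level k /\ level j `<=` level k.
Proof.
by exists (maxn i j); split; apply: level_le; [exact: leq_maxl|exact: leq_maxr].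
Qed.

Lemma level_exists f : exists n, level n f.
Proof.
have g0 i : level i (g i) by rewrite /level /= truncation_gen minnn.
apply: (free_generated V_variety F_free (U := [set f | exists n, level n f])).
- by exists (g 0%N), 0%N.
- move=> o v vn; have [n nP] := directed_family (inhabits 0%N) level_dir vn.
  by exists n; exact: level_op_closed.
- by move=> i; exists i.
Qed.

Lemma evaluation_truncation n r f : ev r (tr n f) = ev (fun i => r (minn i n)) f.
Proof.
apply: (evaluation_unique (h := ev r \o tr n)) => [|i].
  by apply: hom_comp; [exact: truncation_hom|exact: evaluation_hom].
by rewrite /= truncation_gen evaluation_gen.
Qed.

Lemma evaluation_level n r r' f : level n f ->
  (forall i, (i <= n)%N -> r i = r' i) -> ev r f = ev r' f.
Proof.
move=> <- rr; rewrite !evaluation_truncation; congr (ev _ f).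
by apply/funext => i; apply: rr; exact: geq_minr.
Qed.

Section FiniteAlgebra.
Hypothesis A_finite : finite_set [set: A].

Section EmbeddingInPower.
Variables (d : Order.disp_t) (B : ctbDistrLatticeType d).
Hypothesis B_ca : countable_atomless B.
Local Notation X := (stone_space B).

(* Repeatedly splitting \top into as many pieces as A has elements yields
   a continuous surjection from X onto the sequences in A. *)
Lemma free_embeds_boolean_power : embeds F (boolean_power A B).
Proof.
have [m [a [rk [aK rkK]]]] := finite_type_enum A_finite.
have [a0] := algebra_nonempty A; case: m a rk aK rkK => [|m] a rk aK rkK.
  by case: (rk a0).
have /choice[sp spP] (b : B) : exists c : 'I_m.+1 -> B,
    (exists x : X, stone_basic b x) ->
    [/\ forall i, exists x : X, stone_basic (c i) x,
    forall x : X, stone_basic b x <-> exists i, stone_basic (c i) x &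
    forall (x : X) i j, stone_basic (c i) x -> stone_basic (c j) x -> i = j].
  case: (pselect (exists x : X, stone_basic b x)) => [bx|nb].
    by have [c cP] := stone_split B_ca m bx; exists c.
  by exists (fun=> b) => /nb.
have /choice[ch chP] (yb : X * B) : exists i,
    stone_basic yb.2 yb.1 -> stone_basic (sp yb.2 i) yb.1.
  case: (pselect (stone_basic yb.2 yb.1)) => [yb1|nb]; last by exists ord0.
  have [_ /(_ yb.1)[/(_ yb1)[i iP] _] _] := spP yb.2 (ex_intro _ _ yb1).
  by exists i.
(* [path r] is the decreasing sequence of pieces prescribed by the sequence [r], [st y] the one that
   follows the point [y], and [br y] the sequence of choices made by [y]. *)
pose path (r : nat -> 'I_m.+1) := fix path k :=
  if k is j.+1 then sp (path j) (r j) else \top%O.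
pose st (y : X) := fix st k :=
  if k is j.+1 then sp (st j) (ch (y, st j)) else \top%O.
pose br (y : X) k := ch (y, st y k).
have path_br y k : path (br y) k = st y k by elim: k => [//|k IH] /=; rewrite IH.
have st_in y k : stone_basic (st y k) y.
  by elim: k => [|k IH]; [exact: stone_top|exact: (chP (y, st y k))].
have [y0 _] : exists y : X, stone_basic \top%O y.
  by apply: stone_point_exists; have [_ /eqP T0 _] := B_ca => /esym.
have path_in r k : exists y, stone_basic (path r k) y.
  elim: k => [|k IH]; first by exists y0; exact: stone_top.
  by have [/(_ (r k))] := spP _ IH.
have brP r k y : stone_basic (path r k) y ->
    st y k = path r k /\ forall j, (j < k)%N -> br y j = r j.
  elim: k => [//|k IH] yk; have [_ sp2 sp3] := spP _ (path_in r k).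
  have [|stk brk] := IH; first by apply/sp2; exists (r k).
  have E : br y k = r k.
    apply: sp3 (yk); rewrite /br stk; apply: (chP (y, path r k)) => /=.
    by apply/sp2; exists (r k).
  split; first by rewrite /= -/(br y k) E stk.
  by move=> j; rewrite ltnS leq_eqVlt => /orP[/eqP ->|/brk].
pose h (f : F) : power A X := fun y => ev (a \o br y) f.
have hc f : continuous_functions (h f).
  apply/continuous_functionsP => y; have [n fn] := level_exists f.
  exists (st y n.+1); first exact: st_in.
  move=> z; rewrite -path_br => /brP[_ zy].
  by apply: evaluation_level fn _ => i lin /=; rewrite zy.
exists (fun f => exist _ (h f) (hc f)); split.
  move=> o v; apply: sval_inj; apply/funext => y /=.
  exact: evaluation_hom.
move=> f f' /(congr1 sval) /= ff; apply: evaluation_separate => r.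
have [n fn] := level_exists f; have [n' fn'] := level_exists f'.
have [y yP] := path_in (rk \o r) (maxn n n').+1.
have [_ yr] := brP _ _ _ yP.
have E k : (k <= maxn n n')%N -> r k = (a \o br y) k.
  by move=> kn /=; rewrite yr //= rkK.
rewrite (evaluation_level (level_le (leq_maxl n n') fn) E).
rewrite (evaluation_level (level_le (leq_maxr n n') fn') E).
by have /(congr1 (@^~ y)) := ff.
Qed.

End EmbeddingInPower.
End FiniteAlgebra.
End GeneratedByA.

(** * A theta-class that is a subalgebra is rich and countable *)

Section VerbalClass.
Variables (sg : signature) (A : algebra sg) (t : term sg 'I_3).
Hypotheses (A_finite : finite_set [set: A]) (A_simple : simple A).
Hypotheses (mA : malcev_on t A) (nabA : ~ abelian A).
Variables (F : algebra sg) (g : nat -> F).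
Hypothesis F_free : is_free_over (variety_generated (fun P => P = A)) g.
Variable theta : congruence F.
Hypothesis theta_min : is_smallest_congruence_with_quotient_in
  (variety_generated (proper_subalgebras A)) theta.
Variables (S : subuniverse F) (f0 : F).
Hypothesis S_class : forall f, subuniverse_set S f <-> theta f0 f.
Variables (M : nat) (a : 'I_M -> A) (rk : A -> 'I_M).
Hypothesis rkK : cancel rk a.

Local Notation ev := (evaluation F_free).
Local Notation tr := (truncation F_free).
Local Notation level := (level F_free).
Local Notation onto := (onto F_free).

Lemma free_malcev : malcev_on t F.
Proof.
refine (malcev_separated mA _) => f f' ff.
apply: (evaluation_separate (F_free := F_free)) => r.
by apply: ff; exact: evaluation_hom.
Qed.

(** Equivalently, an automorphism of [A] carries [r'] to [r]. *)
Definition conjugate (r r' : nat -> A) :=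
  exists al : A -> A, is_iso al /\ forall f, ev r f = al (ev r' f).

Lemma conjugate_refl r : conjugate r r.
Proof. by exists id; split=> //; exact: iso_id. Qed.

Lemma conjugate_sym r r' : conjugate r r' -> conjugate r' r.
Proof.
move=> [al [isoal alP]]; have [be [isobe alK beK]] := iso_inv isoal.
by exists be; split=> // f; rewrite alP alK.
Qed.

Lemma conjugate_trans r' r r'' : conjugate r r' -> conjugate r' r'' -> conjugate r r''.
Proof.
move=> [al [isoal alP]] [be [isobe beP]]; exists (al \o be).
by split=> [|f]; [exact: iso_comp|rewrite alP beP].
Qed.

Lemma conjugate_onto r r' : conjugate r r' -> onto r -> onto r'.
Proof.
move=> /conjugate_sym[al [isoal alP]] on b.
have [be [_ alK beK]] := iso_inv isoal; have [f fP] := on (be b).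
by exists f; rewrite alP fP beK.
Qed.

Section Level.
Variable n : nat.
Local Notation T := {ffun 'I_n.+1 -> 'I_M}.

(** Stationary after [n], to match the truncation, which sends all later generators to generator
    [n]. *)
Definition tuple_seq (u : T) : nat -> A := fun i => a (u (inord (minn i n))).

Definition seq_tuple (r : nat -> A) : T := [ffun i : 'I_n.+1 => rk (r i)].

Lemma seq_tupleK r : tuple_seq (seq_tuple r) = (fun i => r (minn i n)).
Proof.
apply/funext => i; rewrite /tuple_seq ffunE rkK inordK //.
by rewrite ltnS geq_minr.
Qed.

Lemma tuple_seq_min (u : T) : (fun i => tuple_seq u (minn i n)) = tuple_seq u.
Proof. by apply/funext => i; rewrite /tuple_seq -minnA minnn. Qed.

Lemma evaluation_seq_tuple r f : level n f -> ev r f = ev (tuple_seq (seq_tuple r)) f.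
Proof. by move=> fn; rewrite seq_tupleK -evaluation_truncation fn. Qed.

Lemma evaluation_tuple_tr (u : T) f : ev (tuple_seq u) (tr n f) = ev (tuple_seq u) f.
Proof. by rewrite evaluation_truncation tuple_seq_min. Qed.

Lemma level_ext f f' : level n f -> level n f' ->
  (forall u : T, ev (tuple_seq u) f = ev (tuple_seq u) f') -> f = f'.
Proof.
move=> fn fn' ff; apply: (evaluation_separate (F_free := F_free)) => r.
by rewrite !(evaluation_seq_tuple r) // ff.
Qed.

Definition conjugate_tuple (u v : T) : bool :=
  `[<conjugate (tuple_seq u) (tuple_seq v)>].

(** Canonical because [pick] depends only on the extension of its predicate, which conjugate tuples
    share. *)
Definition tuple_repr (u : T) : T := odflt u [pick v | conjugate_tuple u v].

Lemma tuple_repr_conjugate u : conjugate (tuple_seq u) (tuple_seq (tuple_repr u)).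
Proof.
rewrite /tuple_repr; case: pickP => [v /asboolP//|/(_ u)/asboolP[]].
exact: conjugate_refl.
Qed.

Lemma tuple_repr_eq u v : conjugate (tuple_seq u) (tuple_seq v) ->
  tuple_repr u = tuple_repr v.
Proof.
move=> uv; rewrite /tuple_repr.
have -> : [pick w | conjugate_tuple u w] = [pick w | conjugate_tuple v w].
  apply: eq_pick => w; apply: asbool_equiv_eq; split; apply: conjugate_trans => //.
  exact: conjugate_sym.
by case: pickP => // /(_ v)/asboolP[]; exact: conjugate_refl.
Qed.

Lemma tuple_repr_idem u : tuple_repr (tuple_repr u) = tuple_repr u.
Proof. by symmetry; apply: tuple_repr_eq; exact: tuple_repr_conjugate. Qed.

(** One generating tuple per orbit, so that distinct points have distinct kernels. *)
Definition is_orbit_point (u : T) := `[<onto (tuple_seq u)>] && (tuple_repr u == u).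

Definition orbit_point := {u : T | is_orbit_point u}.

Lemma orbit_point_onto (z : orbit_point) : onto (tuple_seq (val z)).
Proof. by have /andP[/asboolP] := valP z. Qed.

Lemma orbit_point_repr (z : orbit_point) : tuple_repr (val z) = val z.
Proof. by have /andP[_ /eqP] := valP z. Qed.

Lemma tuple_repr_point u : onto (tuple_seq u) ->
  exists z : orbit_point, val z = tuple_repr u.
Proof.
move=> on; have zP : is_orbit_point (tuple_repr u).
  apply/andP; split; last by rewrite tuple_repr_idem.
  by apply/asboolP; apply: conjugate_onto on; exact: tuple_repr_conjugate.
by exists (exist (fun u => is_orbit_point u) _ zP).
Qed.

Lemma orbit_points_independent (s : seq orbit_point) (b : orbit_point -> A) :
  uniq s -> exists f,
    (forall u : T, ~ onto (tuple_seq u) -> ev (tuple_seq u) f = ev (tuple_seq u) f0) /\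
    forall z, z \in s -> ev (tuple_seq (val z)) f = b z.
Proof.
elim: s => [_|z s IH /= /andP[zs us]]; first by exists f0.
have [f [fY fs]] := IH us.
pose k (u : T) := ev (tuple_seq u).
(* The tuples whose values must survive the correction at [z]. None has its kernel below that of
   [z]: it would be conjugate to [z], hence generating and with the same representative. *)
pose L := [seq u <- enum T | ~~ `[<onto (tuple_seq u)>] ||
                             (tuple_repr u == u) && (u != val z)].
have hk u : is_hom (k u) by exact: evaluation_hom.
have [|f' [fL fz]] := independent_kernel A_simple mA nabA free_malcev (hk (val z))
    (orbit_point_onto z) hk (s := L) _ f (b z).
  move=> u; rewrite mem_filter => /andP[uL _]; apply: contrapT => nE.
  have [|al [isoal alP]] := kernel_sub_aut A_finite (hk (val z)) (orbit_point_onto z) (hk u).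
    by move=> h h' hh; apply: contrapT => nhh; apply: nE; exists h, h'.
  have zu : conjugate (tuple_seq (val z)) (tuple_seq u) by exists al.
  have on := conjugate_onto zu (orbit_point_onto z).
  move: uL; rewrite asboolT //= => /andP[/eqP uu /eqP]; apply.
  by rewrite -uu -(tuple_repr_eq zu) orbit_point_repr.
exists f'; split=> [u nu|z'].
  rewrite -fY //; apply: fL; rewrite mem_filter mem_enum andbT.
  by apply/orP; left; apply/asboolP.
rewrite in_cons => /orP[/eqP -> //|z's]; rewrite -fs //; apply: fL.
rewrite mem_filter mem_enum andbT orbit_point_repr eqxx /=.
apply/orP; right; apply/negP => /eqP/val_inj zz.
by rewrite -zz z's in zs.
Qed.

Definition class_level : set (subalgebra S) := [set s | level n (sval s)].

Definition point_value (z : orbit_point) (s : subalgebra S) : A :=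
  ev (tuple_seq (val z)) (sval s).

(** Membership in the class fixes the values at tuples that do not generate [A]. Those at generating
    tuples follow from the orbit points, whose values are free by independence. *)
Lemma class_box : level n f0 -> box point_value class_level.
Proof.
move=> f0n; have thE := verbal_congruenceP F_free theta_min.
split.
- by move=> o v vn; apply: level_op_closed => i; exact: vn.
- by move=> z; exact: hom_comp (sval_embedding S).1 (evaluation_hom _ _).
- move=> s s' sn sn' ss; apply: sval_inj; apply: level_ext => // u.
  case: (pselect (onto (tuple_seq u))) => [on|non].
    have [z zu] := tuple_repr_point on.
    have [al [_ alP]] := tuple_repr_conjugate u.
    by rewrite !alP -zu -/(point_value z s) ss.
  have /S_class/thE/(_ _ non) <- := svalP s.
  by have /S_class/thE/(_ _ non) <- := svalP s'.
- move=> b; have [f [fY fb]] := orbit_points_independent b (enum_uniq {: orbit_point}).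
  (* Truncating stays in the class: if [r] does not generate [A], neither does its truncation, where
     [f] agrees with [f0], itself of level [n]. *)
  have Sf : subuniverse_set S (tr n f).
    apply/S_class/thE => r nr; rewrite evaluation_truncation -seq_tupleK fY.
      by rewrite -evaluation_seq_tuple.
    move=> on; apply: nr => c; have [h hc] := on c.
    by exists (tr n h); rewrite evaluation_truncation -seq_tupleK.
  exists (exist _ (tr n f) Sf); split; first exact: truncation_level.
  move=> z; rewrite /point_value /= evaluation_tuple_tr fb //.
  by rewrite mem_enum.
Qed.

End Level.

(** The sequence [r] is arbitrary, so the bound serves coordinates and constant idempotents
    alike. *)
Lemma orbit_point_count n m N (r : nat -> A) : (n + M + N <= m)%N ->
  (N <= #|[set z : orbit_point m | `[<exists al : A -> A, is_iso al /\
     forall s : subalgebra S, class_level n s -> point_value z s = al (ev r (sval s))>]]%SET|)%N.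
Proof.
move=> nm; have [[b0 [b1 b01]] _] := A_simple.
(* r up to n, then an enumeration of A (so that the sequence is onto and
   conjugacy is equality), then N positions distinguishing the j's. *)
pose ext (j : 'I_N) : nat -> A := fun i => if (i <= n)%N then r i else
  if insub (i - n.+1)%N : option 'I_M is Some k then a k else
  if i == (n.+1 + M + j)%N then b1 else b0.
have ext_r j i : (i <= n)%N -> ext j i = r i by move=> ni; rewrite /ext ni.
have ext_a j (k : 'I_M) : ext j (n.+1 + k)%N = a k.
  by rewrite /ext leqNgt ltnS leq_addr /= addKn valK.
have ext_b j i : ext j (n.+1 + M + i)%N = if i == j then b1 else b0.
  rewrite /ext leqNgt -addnA ltnS leq_addr /= addKn insubN ?addnA ?eqn_add2l //.
  by rewrite -leqNgt leq_addr.
pose u j := seq_tuple m (ext j).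
have uE j i : (i <= m)%N -> tuple_seq (u j) i = ext j i.
  by move=> im; rewrite seq_tupleK (minn_idPl im).
have km (k : 'I_M) : (n.+1 + k <= m)%N.
  by apply: leq_trans nm; rewrite addSn -addnS (leq_trans _ (leq_addr _ _)) // leq_add2l.
have jm (j : 'I_N) : (n.+1 + M + j <= m)%N.
  by apply: leq_trans nm; rewrite !addSn -addnS leq_add2l.
have uon j : onto (tuple_seq (u j)).
  move=> b; exists (g (n.+1 + rk b)%N).
  by rewrite evaluation_gen uE // ext_a rkK.
have /choice[z zP] j := tuple_repr_point (uon j).
have zi : injective z.
  move=> j j' zz; apply/val_inj/eqP; apply: contrapT => /negP jj.
  have [al [_ alP]] : conjugate (tuple_seq (u j)) (tuple_seq (u j')).
    apply: conjugate_trans (tuple_repr_conjugate (u j)) _; rewrite -zP zz zP.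
    exact/conjugate_sym/tuple_repr_conjugate.
  have al_id b : al b = b.
    have := alP (g (n.+1 + rk b)%N).
    by rewrite !evaluation_gen !uE // !ext_a rkK.
  have := alP (g (n.+1 + M + j)%N).
  by rewrite !evaluation_gen !uE // !ext_b eqxx (negPf jj) al_id => /esym.
rewrite -[N in (N <= _)%N]card_ord -(card_imset _ zi).
apply/subset_leq_card/fintype.subsetP => _ /imsetP[j _ ->]; rewrite inE; apply/asboolP.
have [al [isoal alP]] := conjugate_sym (tuple_repr_conjugate (u j)).
exists al; split=> // s sn; rewrite /point_value zP alP; congr al.
apply: evaluation_level sn _ => i ni; rewrite uE ?ext_r //.
by apply: leq_trans nm; rewrite -addnA (leq_trans ni) // leq_addr.
Qed.

Lemma class_rich : rich A (subalgebra S).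
Proof.
move=> E N Efin.
have [||n1 n1P] := directed_finite_set (U := class_level) (inhabits 0%N) _ _ Efin.
- by move=> i j; exists (maxn i j); split=> s; apply: level_le;
    [exact: leq_maxl|exact: leq_maxr].
- by move=> s; exact: level_exists.
have [n0 f0n] := level_exists F_free f0.
have [a0] := algebra_nonempty A.
(* The term [0 + M + 1] is what [orbit_point_count] needs, from level 0, to produce one orbit point
   at level [n]. *)
pose n := maxn (maxn n1 n0) (0 + M + 1); pose m := (n + M + N)%N.
have nm : (n <= m)%N by rewrite /m -addnA leq_addr.
have n0n : (n0 <= n)%N by rewrite !leq_max leqnn orbT.
exists (orbit_point n), (orbit_point m), (@point_value n), (@point_value m),
  (class_level n), (class_level m); split.
- apply: leq_trans (max_card _); apply: (@orbit_point_count 0 n 1 (fun=> a0)).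
  exact: leq_maxr.
- exact/class_box/(level_le n0n).
- exact/class_box/(level_le (leq_trans n0n nm)).
- split; last by move=> s; exact: level_le.
  by move=> s /n1P; apply: level_le; rewrite !leq_max leqnn.
move=> chi chiP.
have [r rP] : exists r, forall s, class_level n s -> chi s = ev r (sval s).
  case: chiP => [[z zP]|[b [bid bP]]]; first by exists (tuple_seq (val z)).
  (* As [b] is idempotent, the evaluation at the constant sequence [b] is constant: the elements it
     sends to [b] are closed and contain the generators. *)
  exists (fun=> b) => s sn; rewrite bP //; symmetry.
  have V_var := variety_generated_variety (fun P => P = A).
  apply: (free_generated V_var F_free (U := [set f | ev (fun=> b) f = b])).
  + by exists (g 0%N); rewrite /= evaluation_gen.
  + by move=> o v vb; rewrite /= evaluation_hom; apply: bid => i; exact: vb.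
  + by move=> i; rewrite /= evaluation_gen.
apply: leq_trans (@orbit_point_count n m N r (leqnn _)) _.
apply/subset_leq_card/fintype.subsetP => z; rewrite inE => /asboolP[al [isoal alP]].
rewrite inE; apply/asboolP; exists al; split=> // s sn.
by rewrite alP // rP.
Qed.

(** An element is determined by a level containing it and its finite table of values on tuples. *)
Lemma class_countable : countable [set: subalgebra S].
Proof.
have /choice[code codeP] (s : subalgebra S) :
    exists c : {n : nat & {ffun {ffun 'I_n.+1 -> 'I_M} -> 'I_M}},
    class_level (tag c) s /\
    forall u, ev (tuple_seq u) (sval s) = a (tagged c u).
  have [n sn] := level_exists F_free (sval s).
  exists (existT (fun n => {ffun {ffun 'I_n.+1 -> 'I_M} -> 'I_M}) n
    [ffun u => rk (ev (tuple_seq u) (sval s))]).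
  by split=> // u; rewrite ffunE rkK.
apply/countable_injP; exists (pickle \o code) => s s' _ _ /= /(pcan_inj pickleK) ss.
have [sn sP] := codeP s; have [sn' sP'] := codeP s'.
apply: sval_inj; rewrite ss in sn sP; apply: level_ext sn sn' _ => u.
by rewrite sP sP'.
Qed.

End VerbalClass.

Theorem theorem1p1 (sg : signature) (A : algebra sg)
    (A_finite : finite_set [set: A]) (A_simple : simple A)
    (A_malcev : malcev A) (A_nonabelian : ~ abelian A)
    (n : nat) (e : 'I_n -> A) (e_inj : injective e)
    (e_idem : forall i, idempotent_elt (e i))
    (e_all : forall a : A, idempotent_elt a -> exists i, a = e i)
    (d : Order.disp_t) (B : ctbDistrLatticeType d)
    (B_countable_atomless : countable_atomless B)
    (x : 'I_n -> stone_space B) (x_inj : injective x) :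
  [/\ JEP (finite_powers A),
      AP (finite_powers A),
      is_generalized_fraisse_limit (finite_powers A)
        (filtered_boolean_power e_idem x_inj) &
      forall D : algebra sg, is_generalized_fraisse_limit (finite_powers A) D ->
        isomorphic D (filtered_boolean_power e_idem x_inj)]
  /\
  forall (F : algebra sg) (g : nat -> F),
    is_free_over (variety_generated (fun P => P = A)) g ->
    forall theta : congruence F,
      is_smallest_congruence_with_quotient_in
        (variety_generated (proper_subalgebras A)) theta ->
      embeds F (boolean_power A B) /\
      forall S : subuniverse F, congruence_class theta S ->
        isomorphic (subalgebra S) (filtered_boolean_power e_idem x_inj).
Proof.
have [t tP] := A_malcev.
have mA : malcev_on t A by move=> a b; exact: tP.
have finK := finite_powers_finite A_finite.
set D := filtered_boolean_power e_idem x_inj.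
have [en enP] := bit_enum_exists B_countable_atomless.
have richD : rich A D.
  exact: (filtered_power_rich B_countable_atomless enP).
have cD : countable [set: D].
  exact: (filtered_power_countable B_countable_atomless enP A_finite).
have covD := rich_covered richD.
have extD := rich_extensible A_finite A_simple mA A_nonabelian richD.
have uniD := rich_universal richD.
(* A copy of [A] in each of the two algebras is the initial partial isomorphism of the
   back-and-forth. *)
have K1 : finite_powers A (power A 'I_1) by exists 1%N.
split; first split.
- exact (covered_JEP finK covD uniD).
- exact (covered_AP finK covD extD uniD).
- exact (covered_is_limit finK covD extD uniD cD).
- move=> D' limD'.
  apply: (covered_extensible_isomorphic finK K1 _ (uniD _ K1) _ _ _ cD covD extD).
  + exact (limit_universal finK limD' K1).
  + by have [] := limD'.
  + exact (limit_covered limD').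
  + exact (limit_extensible finK limD').
move=> F g F_free theta theta_min; split.
  exact (free_embeds_boolean_power F_free A_finite B_countable_atomless).
move=> S [f0 S_class].
have SE f : subuniverse_set S f <-> theta f0 f by rewrite S_class.
have [M [a [rk [aK rkK]]]] := finite_type_enum A_finite.
have richS := class_rich A_finite A_simple mA A_nonabelian F_free theta_min SE rkK.
apply: (covered_extensible_isomorphic finK K1 _ (uniD _ K1) _ _ _ cD covD extD).
- exact (rich_universal richS K1).
- exact (class_countable F_free S rkK).
- exact (rich_covered richS).
- exact (rich_extensible A_finite A_simple mA A_nonabelian richS).
Qed.
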